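(* Let $\eta\in(0,1)$ and $t\in[2,\infty)$. Up to multiplicative constants depending only on $\eta$ and $t$ (in particular uniformly over $d\ge1$, $\sigma_1\ge\dots\ge\sigma_d>0$ and $s\in\{1,\dots,d\}$), $$\epsilon^*(s,t,\Sigma)^t\ \asymp\ \lambda^t s+\nu^t\ \asymp\ \lambda^t s+\sqrt{\sum_{j\le j_*}\sigma_j^{2t}},$$ where $\nu^t=\big[\sum_{j=1}^d\sigma_j^{2t}\exp(-\lambda^2/\sigma_j^2)\big]^{1/2}$ and $j_*=\max\{j\in[d]:\sigma_j\ge\lambda\}$.
   Context: Testing problem. Let $d\ge1$, $[d]=\{1,\dots,d\}$, $\sigma_1\ge\dots\ge\sigma_d>0$ known, $\Sigma=\operatorname{diag}(\sigma_1^2,\dots,\sigma_d^2)$. For $\theta\in\mathbb R^d$, $\mathbb P_\theta$ denotes the law of $X\sim\mathcal N(\theta,\Sigma)$. $\|u\|_t=(\sum_j|u_j|^t)^{1/t}$, $\|u\|_0=\operatorname{Card}\{j:u_j\ne0\}$. For $\epsilon>0$, $s\in[d]$: $\Theta(\epsilon,s,t)=\{\theta\in\mathbb R^d:\|\theta\|_t\ge\epsilon,\ \|\theta\|_0\le s\}$. A test is a measurable $\psi:\mathbb R^d\to\{0,1\}$ of $X$; its risk is $R(\psi,\epsilon,s,t,\Sigma)=\mathbb P_0(\psi=1)+\sup_{\theta\in\Theta(\epsilon,s,t)}\mathbb P_\theta(\psi=0)$; $R^*=\inf_\psi R$ over all tests; $\epsilon^*(s,t,\Sigma)=\inf\{\epsilon>0:R^*(\epsilon,s,t,\Sigma)\le\eta\}$.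 Parameters. Let $\beta\in\mathbb R$ be the unique solution of $$\frac{\sum_{j=1}^d\sigma_j^te^{-\beta/\sigma_j^2}}{\sqrt{\sum_{j=1}^d\sigma_j^{2t}e^{-\beta/\sigma_j^2}}}=\frac s2,\qquad \lambda=\sqrt{\max(\beta,0)}.$$ The maximum of an empty set of indices is $0$, and empty sums are $0$. $f\asymp g$ means $c\,g\le f\le C\,g$ for constants $c,C>0$ depending only on $\eta$ and $t$. *)

(* Defs.v *)
(* MathComp and MathComp-Analysis, over an arbitrary R : realType. *)
From HB Require Import structures.
From mathcomp Require Import all_boot all_order all_algebra.
From mathcomp Require Import all_classical all_reals all_analysis.

Set Implicit Arguments.
Unset Strict Implicit.
Unset Printing Implicit Defensive.
Import Order.TTheory GRing.Theory Num.Theory.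
Import numFieldNormedType.Exports.

Local Open Scope classical_set_scope.
Local Open Scope ring_scope.

Section product_probability.
Context {disp : measure_display} {T : measurableType disp} {R : realType}.

Definition tcons d (p : T * d.-tuple T) : d.+1.-tuple T := [tuple of p.1 :: p.2].

Lemma measurable_tcons d : measurable_fun [set: T * d.-tuple T] (@tcons d).
Proof. exact: measurable_cons. Qed.

HB.instance Definition _ d :=
  isMeasurableFun.Build _ _ _ _ (@tcons d) (@measurable_tcons d).

(* P_0 \x ... \x P_(d-1); the characteristic property is [product_probE]. *)
Fixpoint product_prob d :
    ('I_d -> probability T R) -> probability (d.-tuple T) R :=
  match d with
  | 0 => fun _ => (dirac [tuple] : probability _ R)
  | n.+1 => fun P => distribution
      (P ord0 \x product_prob (fun i => P (lift ord0 i)))%E (@tcons n)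
  end.

Lemma product_probE d (P : 'I_d -> probability T R) (A : 'I_d -> set T) :
  (forall i, measurable (A i)) ->
  product_prob P [set x | forall i, A i (tnth x i)] = (\prod_(i < d) P i (A i))%E.
Proof.
elim: d => [|d IH] in P A *; move=> mA.
  by rewrite big_ord0 /= diracE mem_set //; case.
rewrite big_ord_recl -IH; last by move=> i; exact: mA.
rewrite /= -product_measure1E //; last first.
  rewrite (_ : mkset _ = \bigcap_(i in [set: 'I_d])
      ((fun x : d.-tuple T => tnth x i) @^-1` A (lift ord0 i))).
    apply: fin_bigcap_measurable => // i _.
    rewrite -[X in measurable X]setTI.
    exact: measurable_tnth.
  by apply/seteqP; split => x /= H i; [move=> _; exact: H|exact: H].
rewrite /distribution /pushforward; congr (_ _).
apply/seteqP; split => -[a x] /=.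
  move=> H; split => [|i]; first exact: (H ord0).
  by have := H (lift ord0 i); rewrite tnthS.
move=> [Ha Hx] i; case: (unliftP ord0 i) => [j|] ->; last exact: Ha.
by rewrite tnthS; exact: Hx.
Qed.

End product_probability.

Section testing.
Context {R : realType} {d : nat}.
Implicit Types (theta : d.-tuple R) (sigma : 'I_d -> R) (t eps eta : R).
Implicit Types (s : nat) (psi : d.-tuple (measurableTypeR R) -> bool).

(* N(theta, diag(sigma_j ^ 2)) on R^d; the second parameter of [normal_prob] is
   the standard deviation. The sigma-algebra of [d.-tuple (measurableTypeR R)]
   is generated by the coordinate maps to R: it is the Borel one on R^d. *)
Definition gauss sigma theta : probability (d.-tuple (measurableTypeR R)) R :=
  product_prob (fun j => normal_prob (tnth theta j) (sigma j)).

Definition norm_t t theta : R := (\sum_(j < d) `|tnth theta j| `^ t) `^ t^-1.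

Definition norm_0 theta : nat := #|[pred j : 'I_d | tnth theta j != 0]|.

Definition Theta eps s t : set (d.-tuple R) :=
  [set theta | eps <= norm_t t theta /\ (norm_0 theta <= s)%N].

Definition risk psi eps s t sigma : \bar R :=
  (gauss sigma (nseq_tuple d 0%R) [set x | psi x = true] +
   ereal_sup [set gauss sigma theta [set x | psi x = false]
             | theta in Theta eps s t])%E.

Definition minimax_risk eps s t sigma : \bar R :=
  ereal_inf [set risk psi eps s t sigma
            | psi in [set psi | measurable_fun setT psi]].

(* An infimum in [\bar R]: it would be [+oo] if no eps were admissible. *)
Definition eps_star eta s t sigma : \bar R :=
  ereal_inf [set eps%:E
            | eps in [set eps | 0 < eps /\
                                (minimax_risk eps s t sigma <= eta%:E)%E]].

Definition beta_equation s t sigma (b : R) : Prop :=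
  (\sum_(j < d) sigma j `^ t * expR (- b / sigma j ^+ 2)) /
  Num.sqrt (\sum_(j < d) sigma j `^ (2 * t) * expR (- b / sigma j ^+ 2))
  = s%:R / 2.

(* For sigma > 0, t >= 2 and 1 <= s, the left-hand side decreases strictly and
   continuously in b from +oo to 0, so the equation has exactly one solution. *)
Definition beta s t sigma : R := xget 0 [set b | beta_equation s t sigma b].

Definition lambda s t sigma : R := Num.sqrt (Num.max (beta s t sigma) 0).

(* nu ^ t *)
Definition nu_t s t sigma : R :=
  Num.sqrt (\sum_(j < d) sigma j `^ (2 * t) *
              expR (- lambda s t sigma ^+ 2 / sigma j ^+ 2)).

(* j_* in {0, ..., d}, counting from 1: the index j < d is the (j+1)-st. *)
Definition j_star s t sigma : nat :=
  (\max_(j < d | (lambda s t sigma <= sigma j)%R) j.+1)%N.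

End testing.

(* Main.v *)
(** Upper bound. With tau = sqrt 2 * lambda, the statistic
    T = sum_j (|X_j| - tau)_+ ^ t is centred at its null mean and compared with
    a multiple of lambda^t s + nu^t. Under the null its variance is
    O(nu^(2t)), because (|x| - tau)_+ ^ (2t) is dominated by exponentials. Under
    the alternative, (|x| - tau)_+ ^ t is even and convex enough that a shift
    theta_j raises its mean by at least (|theta_j| - tau)_+ ^ t / 2, which sums
    to c ||theta||_t^t - C lambda^t s over the support; Chebyshev concludes.

    Lower bound. A finitely supported prior with chi-square divergence at most
    delta^2 and mass at most delta outside the alternative forces the risk above
    1 - 2 delta. For beta > 0 the equation says precisely that
    pi_j = sigma_j^t exp(- lambda^2 / sigma_j^2) / nu^t sums to s / 2 (for
    beta <= 0 the sum is at most s / 2), while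
    sum_j pi_j^2 exp(lambda^2 / sigma_j^2) = 1 always holds, and this second sum
    controls the chi-square divergence. When s is large, independent random
    signs of amplitude c lambda, switched on with probability pi_j, give
    lambda^t s; amplitudes c sigma_j on {sigma_j >= lambda}, switched on with
    probability proportional to sigma_j^t, give nu^t. When s is bounded, or when
    sigma_1 dominates, a single random coordinate is enough. *)
Require Import Defs.
From mathcomp Require Import all_boot all_order all_algebra.
From mathcomp Require Import all_classical all_reals all_analysis.
From mathcomp Require Import measurable_realfun ring lra.

Set Implicit Arguments.
Unset Strict Implicit.
Unset Printing Implicit Defensive.
Import Order.TTheory GRing.Theory Num.Theory.
Import numFieldNormedType.Exports.
Local Open Scope classical_set_scope.
Local Open Scope ring_scope.

(** * Gaussian and product integrals *)

(** Under the alternative the variance of T grows with theta, so for Chebyshev a bound of order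
    (||theta||_t^t)^2 is not enough: its constant must be small against eta. Hence the free
    parameter [a] in [powR_add_le] and [truncpow_perturb]: the coefficient (1 + a)^t - 1 of
    |theta_j|^t can be made arbitrarily small, at the price of a larger multiple of the noise, which
    the rate absorbs. The condition t >= 2 enters by writing x^t = (x^2)^(t/2), a convex and
    superadditive function of x^2. Under the product priors both the support size and the norm are
    random, and Chebyshev controls them only when delta s exceeds a constant and no single
    coordinate carries the norm; this is the origin of the case distinctions in
    [minimax_risk_lower]. Both risk bounds are stated for any [lam] and [nu] satisfying the
    relations they use, so that the equation for beta enters only through [lambda_wsum]. *)

Section density.
Context d (T : measurableType d) (R : realType).
Variables (mu nu : {measure set T -> \bar R}) (f : T -> R).
Hypotheses (mf : measurable_fun setT f) (f0 : forall x, 0 <= f x).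
Hypothesis nuE : forall A, measurable A ->
  nu A = (\int[mu]_(x in A) (f x)%:E)%E.
Local Open Scope ereal_scope.
Import HBNNSimple.

Let mfE : measurable_fun [set: T] (fun x => (f x)%:E).
Proof. exact/measurable_EFinP. Qed.

Let ge0_integral_density_nnsfun (h : {nnsfun T >-> R}) :
  \int[nu]_x (h x)%:E = \int[mu]_x ((h x)%:E * (f x)%:E).
Proof.
transitivity (\sum_(r \in range h) r%:E * nu (h @^-1` [set r])).
  by rewrite integralT_nnsfun sintegralE.
transitivity (\int[mu]_x (\sum_(r \in range h)
    (r * \1_(h @^-1` [set r]) x)%:E * (f x)%:E)); last first.
  apply: eq_integral => x _; rewrite -ge0_mule_fsuml; last first.
    by move=> r; exact: nnfun_muleindic_ge0.
  by rewrite fsumEFin // -(fimfunE h x).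
rewrite ge0_integral_fsum//; last 2 first.
- by move=> r; apply: emeasurable_funM => //; apply/measurable_EFinP/measurable_funM.
- by move=> r x _; apply: mule_ge0; [exact: nnfun_muleindic_ge0|rewrite lee_fin].
apply: eq_fsbigr => r /[!inE] -[x _ <-].
under eq_integral do rewrite EFinM -muleA.
rewrite ge0_integralZl//; last 3 first.
- by apply: emeasurable_funM => //; apply/measurable_EFinP.
- by move=> y _; rewrite mule_ge0 ?lee_fin.
- by rewrite lee_fin.
rewrite nuE//; congr (_ * _).
rewrite integral_mkcond; apply: eq_integral => y _.
by rewrite epatch_indic muleC.
Qed.

(** Simple functions, then monotone convergence. It is applied to normal densities with respect to
    Lebesgue measure. *)
Lemma ge0_integral_density (g : T -> \bar R) :
  measurable_fun setT g -> (forall x, 0 <= g x) ->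
  \int[nu]_x g x = \int[mu]_x (g x * (f x)%:E).
Proof.
move=> mg g0; pose h := nnsfun_approx measurableT mg.
transitivity (limn (fun n => \int[nu]_x (h n x)%:E)).
  rewrite -monotone_convergence//.
  - apply: eq_integral => x _; apply/esym/cvg_lim => //.
    exact: cvg_nnsfun_approx.
  - by move=> n; exact/measurable_EFinP.
  - by move=> n x _; rewrite lee_fin.
  - by move=> x _ a b ab; rewrite lee_fin; exact/lefP/nd_nnsfun_approx.
under eq_fun do rewrite ge0_integral_density_nnsfun.
rewrite -monotone_convergence//.
- apply: eq_integral => x _; apply/cvg_lim => //; apply: cvgeZr => //.
  exact: cvg_nnsfun_approx.
- by move=> n; apply: emeasurable_funM => //; exact/measurable_EFinP.
- by move=> n x _; rewrite mule_ge0 ?lee_fin.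
- move=> x _ a b ab; rewrite lee_wpmul2r ?lee_fin//.
  exact/lefP/nd_nnsfun_approx.
Qed.

End density.

Section lebesgue_translation.
Context (R : realType).
Notation mu := (@lebesgue_measure R).

(** Lebesgue measure is determined by its values on half-open intervals, and a translation preserves
    their lengths. *)
Lemma lebesgue_measure_shift (c : R) (A : set R) : measurable A ->
  pushforward mu ((fun x => x + c) : _ -> measurableTypeR R) A = mu A.
Proof.
move=> mA; apply/esym/lebesgue_measure_unique => //=.
  exact: measurable_funD.
move=> _ _ [[a b]] _ <-.
rewrite /pushforward [X in _ = mu X](_ : _ = `]a - c, b - c]%classic); last first.
  by apply/seteqP; split => x /=; rewrite !in_itv/= ltrBlDr lerBrDr.
rewrite !lebesgue_measure_itv/= !lte_fin ltrD2r/=; case: ifP => // _.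
by rewrite -!EFinB; congr (_%:E); ring.
Qed.

Lemma ge0_integral_shift (c : R) (f : R -> \bar R) :
  measurable_fun setT f -> (forall x, (0 <= f x)%E) ->
  (\int[mu]_x f (x + c)%R = \int[mu]_x f x)%E.
Proof.
move=> mf f0.
have mc : measurable_fun setT ((fun x => x + c) : R -> measurableTypeR R).
  exact: measurable_funD.
transitivity (\int[pushforward mu ((fun x => x + c)%R : R -> measurableTypeR R)]_x
    f x)%E.
  by rewrite ge0_integral_pushforward// preimage_setT.
apply: eq_measure_integral => A mA _; exact: lebesgue_measure_shift.
Qed.

Lemma ge0_integral_opp (f : R -> \bar R) :
  measurable_fun setT f -> (forall x, (0 <= f x)%E) ->
  (\int[mu]_x f (- x)%R = \int[mu]_x f x)%E.
Proof.
move=> mf f0.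
have mc : measurable_fun setT (-%R : R -> measurableTypeR R) by [].
transitivity (\int[pushforward mu (-%R : R -> measurableTypeR R)]_x f x)%E.
  by rewrite ge0_integral_pushforward// preimage_setT.
apply: eq_measure_integral => A mA _; exact: lebesgue_measureN.
Qed.

End lebesgue_translation.

Section normal_integrals.
Context (R : realType).
Implicit Types (m s b : R) (g : R -> \bar R).
Notation mu := (@lebesgue_measure R).

Lemma ge0_integral_normal_prob m s g :
  measurable_fun setT g -> (forall x, (0 <= g x)%E) ->
  (\int[normal_prob m s]_x g x = \int[mu]_x (g x * (normal_pdf m s x)%:E))%E.
Proof.
move=> mg g0; apply: ge0_integral_density => //.
- exact: measurable_normal_pdf.
- by move=> x; exact: normal_pdf_ge0.
Qed.

Lemma ge0_integral_normal_shift m s g : s != 0 ->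
  measurable_fun setT g -> (forall x, (0 <= g x)%E) ->
  (\int[normal_prob m s]_x g x = \int[normal_prob 0 s]_x g (x + m)%R)%E.
Proof.
move=> s0 mg g0.
have mgm : measurable_fun setT (fun x : R => g (x + m)).
  by apply: measurableT_comp => //; exact: measurable_funD.
rewrite (ge0_integral_normal_prob m s mg g0).
rewrite (ge0_integral_normal_prob 0 s mgm (fun x => g0 (x + m))).
rewrite -(@ge0_integral_shift R m (fun x => g x * (normal_pdf m s x)%:E)%E).
- apply: eq_integral => x _; congr (_ * _%:E)%E.
  by rewrite !normal_pdfE// /normal_fun subr0 addrK.
- apply: emeasurable_funM => //; apply/measurable_EFinP.
  exact: measurable_normal_pdf.
- by move=> x; rewrite mule_ge0// lee_fin normal_pdf_ge0.
Qed.

Lemma ge0_integral_normal_opp s g : s != 0 ->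
  measurable_fun setT g -> (forall x, (0 <= g x)%E) ->
  (\int[normal_prob 0 s]_x g (- x)%R = \int[normal_prob 0 s]_x g x)%E.
Proof.
move=> s0 mg g0.
have mgm : measurable_fun setT (fun x : R => g (- x)).
  exact: measurableT_comp.
rewrite (ge0_integral_normal_prob 0 s mg g0).
rewrite (ge0_integral_normal_prob 0 s mgm (fun x => g0 (- x))).
rewrite -(@ge0_integral_opp R (fun x => g x * (normal_pdf 0 s x)%:E)%E).
- apply: eq_integral => x _; congr (_ * _%:E)%E.
  by rewrite !normal_pdfE// /normal_fun !subr0 sqrrN.
- apply: emeasurable_funM => //; apply/measurable_EFinP.
  exact: measurable_normal_pdf.
- by move=> x; rewrite mule_ge0// lee_fin normal_pdf_ge0.
Qed.

(** The likelihood ratio of N(m, s^2) with respect to N(0, s^2). *)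
Definition normal_lr m s x := expR (x * m / s ^+ 2 - m ^+ 2 / (2 * s ^+ 2)).

Lemma measurable_normal_lr m s : measurable_fun setT (normal_lr m s).
Proof.
apply: measurableT_comp => //; apply: measurable_funB => //.
by apply: measurable_funM => //; exact: measurable_funM.
Qed.

Lemma ge0_integral_normal_lr m s g : s != 0 ->
  measurable_fun setT g -> (forall x, (0 <= g x)%E) ->
  (\int[normal_prob m s]_x g x =
   \int[normal_prob 0 s]_x (g x * (normal_lr m s x)%:E))%E.
Proof.
move=> s0 mg g0; rewrite (ge0_integral_normal_prob m s mg g0).
have mglr : measurable_fun setT (fun x => g x * (normal_lr m s x)%:E)%E.
  apply: emeasurable_funM => //; apply/measurable_EFinP.
  exact: measurable_normal_lr.
rewrite (ge0_integral_normal_prob 0 s mglr); last first.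
  by move=> x; rewrite mule_ge0// lee_fin expR_ge0.
apply: eq_integral => x _; rewrite -muleA -EFinM; congr (_ * _%:E)%E.
rewrite !normal_pdfE// /normal_fun /normal_lr mulrCA -expRD; congr (_ * expR _).
by field.
Qed.

(** Exponential tilting: up to the constant on the right, exp(b x) is the likelihood ratio for the
    mean b s^2, which integrates to 1. *)
Lemma integral_expR_normal s b : s != 0 ->
  (\int[normal_prob 0 s]_x (expR (b * x))%:E
   = (expR (b ^+ 2 * s ^+ 2 / 2))%:E)%E.
Proof.
move=> s0.
have mlr : measurable_fun setT (fun x => (normal_lr (b * s ^+ 2) s x)%:E).
  by apply/measurable_EFinP; exact: measurable_normal_lr.
transitivity (\int[normal_prob 0 s]_x ((expR (b ^+ 2 * s ^+ 2 / 2))%:E *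
   (normal_lr (b * s ^+ 2) s x)%:E))%E.
  apply: eq_integral => x _; rewrite -EFinM -expRD; congr (expR _)%:E.
  by field.
rewrite ge0_integralZl//; last by move=> x _; rewrite lee_fin expR_ge0.
rewrite (_ : \int[_]_x _ = 1)%E ?mule1//.
transitivity (\int[normal_prob 0 s]_x
    (cst 1 x * (normal_lr (b * s ^+ 2) s x)%:E))%E.
  by apply: eq_integral => x _; rewrite mul1e.
rewrite -(ge0_integral_normal_lr (b * s ^+ 2) s0)//.
by rewrite (integral_cst _ measurableT 1%E) mul1e; exact: probability_setT.
Qed.

End normal_integrals.

Section product_integrals.
Context {disp : measure_display} {T : measurableType disp} {R : realType}.
Local Open Scope ereal_scope.

Lemma ge0_integral_product_probS n (P : 'I_n.+1 -> probability T R)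
    (g : n.+1.-tuple T -> \bar R) :
  measurable_fun setT g -> (forall x, 0 <= g x) ->
  \int[product_prob P]_x g x =
  \int[P ord0]_x \int[product_prob (fun i : 'I_n => P (lift ord0 i))]_y
    g (tcons (x, y)).
Proof.
move=> mg g0 /=.
rewrite ge0_integral_distribution//.
rewrite fubini_tonelli1//.
  by apply: measurableT_comp => //; exact: measurable_tcons.
by move=> x /=.
Qed.

(** The one-dimensional change of measure is assumed for every nonnegative function because the
    induction applies it to the inner integral over the remaining coordinates. *)
Lemma ge0_integral_product_prob_density n (P Q : 'I_n -> probability T R)
    (f : 'I_n -> T -> R) :
  (forall i, measurable_fun setT (f i)) -> (forall i x, (0 <= f i x)%R) ->
  (forall i (g : T -> \bar R), measurable_fun setT g -> (forall x, 0 <= g x) ->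
     \int[P i]_x g x = \int[Q i]_x (g x * (f i x)%:E)) ->
  forall g : n.-tuple T -> \bar R, measurable_fun setT g ->
    (forall x, 0 <= g x) ->
  \int[product_prob P]_x g x =
  \int[product_prob Q]_x (g x * (\prod_(i < n) f i (tnth x i))%:E).
Proof.
elim: n => [|n IH] in P Q f *; move=> mf f0 PQ g mg g0.
  by apply: eq_integral => x _; rewrite big_ord0 mule1.
have mprod k (h : 'I_k -> T -> R) : (forall i, measurable_fun setT (h i)) ->
    measurable_fun setT (fun x : k.-tuple T =>
      (\prod_(i < k) h i (tnth x i))%R%:E).
  move=> mh; apply/measurable_EFinP; apply: measurable_prod => i _.
  by apply: measurableT_comp => //; exact: measurable_tnth.
have prod_ge0 k (h : 'I_k -> T -> R) (x : k.-tuple T) :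
    (forall i x, (0 <= h i x)%R) -> 0 <= (\prod_(i < k) h i (tnth x i))%R%:E.
  by move=> h0; rewrite lee_fin prodr_ge0.
rewrite !ge0_integral_product_probS//; last 2 first.
- by apply: emeasurable_funM => //; exact: mprod.
- by move=> x; rewrite mule_ge0// prod_ge0.
have mgt x : measurable_fun setT (fun y => g (tcons (x, y))).
  by apply: measurableT_comp => //; apply: measurableT_comp;
    [exact: measurable_tcons|exact: measurable_pair1].
rewrite (PQ ord0); last 2 first.
- apply: (@measurable_fun_fubini_tonelli_F _ _ _ _ _ _ (g \o tcons (T:=T) (d:=n))).
  + by apply: measurableT_comp => //; exact: measurable_tcons.
  + by move=> x /=.
- by move=> x; apply: integral_ge0.
apply: eq_integral => x _.
rewrite (IH _ (fun i => Q (lift ord0 i)) (fun i => f (lift ord0 i)))//; last first.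
  by move=> i; exact: PQ.
rewrite -ge0_integralZr ?lee_fin//; last 2 first.
- by apply: emeasurable_funM => //; exact: (mprod _ (fun i => f (lift ord0 i))).
- by move=> y _; apply: mule_ge0 => //; exact: (prod_ge0 _ (fun i => f (lift ord0 i))).
apply: eq_integral => y _.
rewrite -muleA -EFinM; congr (_ * _%:E).
rewrite big_ord_recl mulrC; congr (_ * _)%R.
by apply: eq_bigr => i _; rewrite tnthS.
Qed.

Lemma ge0_integral_product_prob_tnth n (P : 'I_n -> probability T R) (j : 'I_n)
    (g : T -> \bar R) : measurable_fun setT g -> (forall x, 0 <= g x) ->
  \int[product_prob P]_x g (tnth x j) = \int[P j]_x g x.
Proof.
move=> mg g0.
have mt : measurable_fun setT (fun x : n.-tuple T => tnth x j).
  exact: measurable_tnth.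
transitivity (\int[pushforward (product_prob P) (fun x => tnth x j)]_x g x).
  by rewrite ge0_integral_pushforward// preimage_setT.
apply: eq_measure_integral => A mA _; rewrite /pushforward.
have := @product_probE _ _ R n P (fun i => if i == j then A else setT).
rewrite (bigD1 j)//= eqxx big1 ?mule1; last first.
  by move=> i /negPf ->; rewrite probability_setT.
move=> <-; last by move=> i; case: ifP.
congr (product_prob P _); apply/seteqP; split => x /=.
  by move=> Ax i; case: eqP => // ->.
by move=> /(_ j); rewrite eqxx.
Qed.

End product_integrals.

(** * Second moments, Chebyshev's inequality, sums of independent variables *)

Section second_moments.
Context {disp : measure_display} {T : measurableType disp} {R : realType}.
Local Open Scope ereal_scope.

Lemma integral_probability_cst (P : probability T R) (r : \bar R) :
  \int[P]_x r = r.
Proof. by rewrite (integral_cst P measurableT r) [X in _ * X](probability_setT P) mule1. Qed.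

Lemma integrable_of_sqr (P : probability T R) (h : T -> R) :
  measurable_fun setT h -> \int[P]_x ((h x) ^+ 2)%:E < +oo ->
  P.-integrable setT (fun x => (h x)%:E).
Proof.
move=> mh h2.
have mh2 : measurable_fun setT (fun x => (h x ^+ 2)%:E).
  by apply/measurable_EFinP; exact: measurable_funX.
apply: (@le_integrable _ _ _ _ _ measurableT _
  (fun x => (1 + h x ^+ 2)%:E)) => //.
- exact/measurable_EFinP.
- move=> x _; rewrite !abse_EFin lee_fin [leRHS]ger0_norm ?addr_ge0 ?sqr_ge0//.
  have := sqr_ge0 (`|h x| - 1); rewrite sqrrB real_normK ?num_real// => H.
  by have := normr_ge0 (h x); nra.
- apply: (@eq_integrable _ _ _ _ _ measurableT
    (fun x => 1%E + (h x ^+ 2)%:E)) => //.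
  apply: integrableD => //.
  + exact: finite_measure_integrable_cst.
  + apply/integrableP; split => //.
    by under eq_integral do rewrite gee0_abs ?lee_fin ?sqr_ge0//.
Qed.

(** The inductive step for variances of independent sums: with one coordinate frozen at the value
    [a], the cross term vanishes because [S] is centred. *)
Lemma integral_sqrD_le (P : probability T R) (S : T -> R) (a V : R) :
  measurable_fun setT S -> \int[P]_x (S x)%:E = 0 ->
  \int[P]_x (S x ^+ 2)%:E <= V%:E ->
  \int[P]_x ((a + S x) ^+ 2)%:E <= (a ^+ 2 + V)%:E.
Proof.
move=> mS S0 S2.
have iS : P.-integrable setT (fun x => (S x)%:E).
  by apply: integrable_of_sqr => //; rewrite (le_lt_trans S2)// ltry.
have iS2 : P.-integrable setT (fun x => (S x ^+ 2)%:E).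
  apply/integrableP; split.
    by apply/measurable_EFinP; exact: measurable_funX.
  under eq_integral do rewrite gee0_abs ?lee_fin ?sqr_ge0//.
  by rewrite (le_lt_trans S2)// ltry.
rewrite [leLHS](_ : _ =
  \int[P]_x ((a ^+ 2)%:E + ((2 * a)%:E * (S x)%:E + (S x ^+ 2)%:E))); last first.
  apply: eq_integral => x _; rewrite -EFinM -!EFinD; congr (_%:E); ring.
rewrite integralD//; last 2 first.
- exact: finite_measure_integrable_cst.
- by apply: integrableD => //; exact: integrableZl.
rewrite integralD//; last exact: integrableZl.
rewrite integralZl// S0 mule0 add0e integral_probability_cst.
by rewrite EFinD leeD2l.
Qed.

Lemma chebyshev_sqr (P : probability T R) (S : T -> R) (a V : R) :
  measurable_fun setT S -> (0 < a)%R -> \int[P]_x (S x ^+ 2)%:E <= V%:E ->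
  P [set x | (a <= `|S x|)%R] <= (V / a ^+ 2)%:E.
Proof.
move=> mS a0 S2.
have mS2 : measurable_fun setT (fun x => (S x ^+ 2)%:E).
  by apply/measurable_EFinP; exact: measurable_funX.
have a20 : (0 < a ^+ 2)%R by rewrite exprn_gt0.
have := le_integral_abse P measurableT mS2 a20.
under eq_integral do rewrite gee0_abs ?lee_fin ?sqr_ge0//.
rewrite setTI => /le_trans/(_ S2).
rewrite (_ : [set x | _] = [set x | (a <= `|S x|)%R]); last first.
  by apply/seteqP; split => x /=; rewrite normrX lee_fin ler_pXn2r ?nnegrE// ltW.
by rewrite [(V / _)%:E]EFinM lee_pdivlMr// muleC.
Qed.

End second_moments.

Section product_second_moments.
Context {disp : measure_display} {T : measurableType disp} {R : realType}.
Local Open Scope ereal_scope.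

Lemma integral_product_prob_tnth n (P : 'I_n -> probability T R) (j : 'I_n)
    (h : T -> R) : measurable_fun setT h ->
  \int[product_prob P]_x (h (tnth x j))%:E = \int[P j]_x (h x)%:E.
Proof.
move=> mh; have mhE : measurable_fun setT (fun x => (h x)%:E).
  exact/measurable_EFinP.
rewrite integralE [RHS]integralE; congr (_ - _).
- rewrite -(ge0_integral_product_prob_tnth P j (measurable_funepos mhE))//.
  by apply: eq_integral => x _; rewrite !funeposE.
- rewrite -(ge0_integral_product_prob_tnth P j (measurable_funeneg mhE))//.
  by apply: eq_integral => x _; rewrite !funenegE.
Qed.

(** Tonelli is applied only to squares. The signed mean of the remaining sum is computed through the
    marginals, its integrability coming from the second moments. *)
Lemma integral_sum_sqr_product_prob n (P : 'I_n -> probability T R)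
    (h : 'I_n -> T -> R) (v : 'I_n -> R) :
  (forall i, measurable_fun setT (h i)) ->
  (forall i, \int[P i]_x (h i x)%:E = 0) ->
  (forall i, \int[P i]_x (h i x ^+ 2)%:E <= (v i)%:E) ->
  \int[product_prob P]_x ((\sum_(i < n) h i (tnth x i)) ^+ 2)%:E
  <= (\sum_(i < n) v i)%:E.
Proof.
elim: n => [|n IH] in P h v *; move=> mh h0 hv.
  rewrite big_ord0 (eq_integral (cst 0)) ?integral0// => x _.
  by rewrite big_ord0 expr0n.
have mt k (j : 'I_k) : measurable_fun setT (fun x : k.-tuple T => tnth x j).
  exact: measurable_tnth.
rewrite ge0_integral_product_probS; last 2 first.
- apply/measurable_EFinP; apply: measurable_funX; apply: measurable_sum => i.
  exact: (measurableT_comp (mh i) (mt _ i)).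
- by move=> x; rewrite lee_fin sqr_ge0.
set P' := fun i : 'I_n => P (lift ord0 i).
set S := fun y : n.-tuple T => (\sum_(i < n) h (lift ord0 i) (tnth y i))%R.
set V := (\sum_(i < n) v (lift ord0 i))%R.
have mS : measurable_fun setT S.
  by apply: measurable_sum => i; exact: (measurableT_comp (mh _) (mt _ i)).
have S2 : \int[product_prob P']_y (S y ^+ 2)%:E <= V%:E.
  apply: (IH P' (fun i => h (lift ord0 i)) (fun i => v (lift ord0 i))) => i.
  + exact: mh.
  + exact: h0.
  + exact: hv.
have S0 : \int[product_prob P']_y (S y)%:E = 0.
  under eq_integral do rewrite -sumEFin.
  rewrite integral_sum//.
    rewrite big1// => i _.
    by rewrite (integral_product_prob_tnth P' i (mh (lift ord0 i))) h0.
  move=> i; apply: (integrable_of_sqr (P := product_prob P')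
    (h := fun y => h (lift ord0 i) (tnth y i))); first exact: (measurableT_comp (mh _) (mt _ i)).
  rewrite (ge0_integral_product_prob_tnth P' i
    (g := fun x => (h (lift ord0 i) x ^+ 2)%:E)).
  - by rewrite (le_lt_trans (hv _))// ltry.
  - by apply/measurable_EFinP; exact: measurable_funX.
  - by move=> x; rewrite lee_fin sqr_ge0.
have V0 : (0 <= V)%R.
  by rewrite -lee_fin (le_trans _ S2)//; apply: integral_ge0 => x _; rewrite lee_fin sqr_ge0.
have mh2 : measurable_fun setT (fun x => (h ord0 x ^+ 2)%:E).
  by apply/measurable_EFinP; exact: measurable_funX.
apply: (@le_trans _ _ (\int[P ord0]_x ((h ord0 x ^+ 2)%:E + V%:E))).
  apply: ge0_le_integral => //.
  - by move=> x _; apply: integral_ge0 => y _; rewrite lee_fin sqr_ge0.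
  - apply: (@measurable_fun_fubini_tonelli_F _ _ _ _ _ _
      (fun z => ((\sum_(i < n.+1) h i (tnth (tcons z) i)) ^+ 2)%:E)) => //.
      apply/measurable_EFinP; apply: measurable_funX; apply: measurable_sum => i.
      apply: (measurableT_comp (mh i)); apply: (measurableT_comp (mt _ i)).
      exact: measurable_tcons.
    by move=> x; rewrite lee_fin sqr_ge0.
  - by apply: emeasurable_funD.
  - move=> x _; rewrite -EFinD.
    rewrite (_ : \int[_]_y _ = \int[product_prob P']_y ((h ord0 x + S y) ^+ 2)%:E).
      exact: integral_sqrD_le.
    apply: eq_integral => y _; rewrite big_ord_recl; congr ((_ + _) ^+ 2)%:E.
    by apply: eq_bigr => i _; rewrite tnthS.
rewrite ge0_integralD//; last by move=> x _; rewrite lee_fin sqr_ge0.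
by rewrite big_ord_recl EFinD integral_probability_cst; apply: leeD; [exact: hv|].
Qed.

End product_second_moments.

(** * The truncated power *)

Section powR_inequalities.
Context (R : realType).
Implicit Types (u v w p q t tau x y : R).

Lemma ler_powR2r p x y : 0 <= p -> 0 <= x -> x <= y -> x `^ p <= y `^ p.
Proof.
by move=> p0 x0 xy; apply: ge0_ler_powR; rewrite ?nnegrE// (le_trans x0).
Qed.

Lemma powR_exprn x p n : 0 <= x -> (x ^+ n) `^ p = x `^ (n%:R * p).
Proof. by move=> x0; rewrite powRrM powR_mulrn. Qed.

Lemma powR_sqr x p : (x `^ p) ^+ 2 = x `^ (2 * p).
Proof. by rewrite mulrC powRrM powR_mulrn ?powR_ge0. Qed.

(** Write u^p = u u^(p-1) and v^p = v v^(p-1), then bound both second factors by (u + v)^(p-1). *)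
Lemma powR_superadditive p u v : 1 <= p -> 0 <= u -> 0 <= v ->
  u `^ p + v `^ p <= (u + v) `^ p.
Proof.
move=> p1 u0 v0.
have p0 : 0 < p by rewrite (lt_le_trans ltr01).
rewrite -(mulr_powRB1 u0 p0) -(mulr_powRB1 v0 p0).
rewrite -(mulr_powRB1 (addr_ge0 u0 v0) p0) mulrDl.
by apply: lerD; apply: ler_wpM2l => //; apply: ler_powR2r;
  rewrite ?subr_ge0// ?lerDl ?lerDr.
Qed.

Lemma powR_midpoint q u v : 1 <= q -> 0 <= u -> 0 <= v ->
  2 * ((u + v) / 2) `^ q <= u `^ q + v `^ q.
Proof.
move=> q1 u0 v0.
have h0 : 0 <= 2^-1 :> R by lra.
have h1 : 2^-1 <= 1 :> R by lra.
have := @convex_powR R q q1 (Itv01 h0 h1) u v.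
rewrite !inE /= !in_itv /= !andbT => /(_ u0 v0).
rewrite !convRE [X in X `^ _]convRE /= (_ : unstable.onem 2^-1 = 2^-1); last first.
  by rewrite /unstable.onem; field.
rewrite (_ : 2^-1 * u + 2^-1 * v = (u + v) / 2); last by field.
by move=> H; lra.
Qed.

(** Clarkson's inequality for reals. The squares (w + v)^2 and (w - v)^2 have mean w^2 + v^2, so
    midpoint convexity of the power t/2 followed by its superadditivity gives the claim. *)
Lemma powR_clarkson t w v : 2 <= t -> 0 <= v -> v <= w ->
  2 * w `^ t + 2 * v `^ t <= (w + v) `^ t + (w - v) `^ t.
Proof.
move=> t2 v0 vw; have w0 := le_trans v0 vw.
have q1 : 1 <= t / 2 by lra.
have E x : 0 <= x -> x `^ t = (x ^+ 2) `^ (t / 2).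
  by move=> x0; rewrite powR_exprn//; congr (_ `^ _); field.
rewrite !E ?subr_ge0 ?addr_ge0//.
apply: le_trans (powR_midpoint q1 (sqr_ge0 _) (sqr_ge0 _)).
rewrite -mulrDr ler_pM2l//.
rewrite (_ : ((w + v) ^+ 2 + (w - v) ^+ 2) / 2 = w ^+ 2 + v ^+ 2); last by field.
by apply: powR_superadditive; rewrite ?sqr_ge0.
Qed.

Lemma powR_addl_ge t w v : 2 <= t -> 0 <= w -> w <= v ->
  2 * w `^ t + v `^ t <= (w + v) `^ t.
Proof.
move=> t2 w0 wv; have v0 := le_trans w0 wv.
have q1 : 1 <= t / 2 by lra.
have E x : 0 <= x -> x `^ t = (x ^+ 2) `^ (t / 2).
  by move=> x0; rewrite powR_exprn//; congr (_ `^ _); field.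
rewrite !E ?addr_ge0//.
have : (w ^+ 2 + w ^+ 2 + v ^+ 2) `^ (t / 2) <= ((w + v) ^+ 2) `^ (t / 2).
  by apply: ler_powR2r; rewrite ?addr_ge0 ?sqr_ge0//; [lra|nra].
apply: le_trans.
apply: le_trans (powR_superadditive q1 _ _); rewrite ?addr_ge0 ?sqr_ge0//.
rewrite lerD2r mulr_natl mulr2n.
by apply: powR_superadditive; rewrite ?sqr_ge0.
Qed.

(** Raise y / p <= exp(y / p) to the power p. *)
Lemma powR_le_expR p y : 0 < p -> 0 <= y -> y `^ p <= p `^ p * expR y.
Proof.
move=> p0 y0.
have -> : expR y = (expR (y / p)) `^ p by rewrite -expRM divfK// gt_eqF.
rewrite -powRM ?expR_ge0 ?(ltW p0)//; apply: ler_powR2r => //; first exact: ltW.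
have /ler_wpM2l : y / p <= expR (y / p).
  by apply: le_trans (expR_ge1Dx _); rewrite lerDr.
by move=> /(_ p (ltW p0)); rewrite mulrCA divff ?mulr1// gt_eqF.
Qed.

(** Either v <= a u or u < v / a, and the smaller term is absorbed in the other. A small [a] brings
    the coefficient of u^t close to 1. *)
Lemma powR_add_le t a u v : 0 < t -> 0 < a -> 0 <= u -> 0 <= v ->
  (u + v) `^ t <= (1 + a) `^ t * u `^ t + (1 + a^-1) `^ t * v `^ t.
Proof.
move=> t0 a0 u0 v0.
have ai0 : 0 < a^-1 by rewrite invr_gt0.
have a1 : 0 <= 1 + a by rewrite addr_ge0// ltW.
have ai1 : 0 <= 1 + a^-1 by rewrite addr_ge0// ltW.
rewrite -!powRM//.
have [vau|auv] := leP v (a * u).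
- rewrite -[leLHS]addr0; apply: lerD; last exact: powR_ge0.
  by apply: ler_powR2r; [exact: ltW|exact: addr_ge0|rewrite mulrDl mul1r lerD2l].
- rewrite -[leLHS]add0r; apply: lerD; first exact: powR_ge0.
  apply: ler_powR2r; [exact: ltW|exact: addr_ge0|].
  by rewrite mulrDl mul1r addrC lerD2l mulrC ler_pdivlMr// mulrC ltW.
Qed.

End powR_inequalities.

Section truncated_power.
Context (R : realType).
Implicit Types (u v w p q t tau x y th : R).

Definition truncpow t tau x : R := (Num.max (`|x| - tau) 0) `^ t.

Lemma truncpow_ge0 t tau x : 0 <= truncpow t tau x.
Proof. exact: powR_ge0. Qed.

Lemma truncpowN t tau x : truncpow t tau (- x) = truncpow t tau x.
Proof. by rewrite /truncpow normrN. Qed.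

Lemma ler_truncpow t tau x y : 0 < t -> `|x| <= `|y| ->
  truncpow t tau x <= truncpow t tau y.
Proof.
move=> t0 xy; apply: ler_powR2r; first exact: ltW.
  by rewrite le_max lexx orbT.
by rewrite ge_max !le_max lexx !orbT ?lerD2r xy.
Qed.

Lemma truncpow_le t tau x : 0 < t -> 0 <= tau -> truncpow t tau x <= `|x| `^ t.
Proof.
move=> t0 tau0; apply: ler_powR2r; first exact: ltW.
  by rewrite le_max lexx orbT.
by rewrite ge_max normr_ge0 andbT gerBl.
Qed.

Lemma truncpow_ge t tau x : 0 < t -> 0 <= tau ->
  `|x| `^ t <= 2 `^ t * (truncpow t tau x + tau `^ t).
Proof.
move=> t0 tau0; set m := Num.max (`|x| - tau) 0.
have m0 : 0 <= m by rewrite le_max lexx orbT.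
have xm : `|x| <= m + tau by rewrite -lerBlDr le_max lexx.
have [mt|tm] := leP m tau.
- apply: (@le_trans _ _ (2 `^ t * tau `^ t)).
    by rewrite -powRM//; apply: ler_powR2r => //; [exact: ltW|lra].
  by rewrite ler_wpM2l ?powR_ge0// lerDr powR_ge0.
- apply: (@le_trans _ _ (2 `^ t * m `^ t)).
    by rewrite -powRM//; apply: ler_powR2r => //; [exact: ltW|lra].
  by rewrite ler_wpM2l ?powR_ge0// lerDl powR_ge0.
Qed.

(** If u <= tau, monotonicity suffices. Otherwise u has excess w = u - tau > 0 over the threshold
    and u + v has excess w + v; if v <= w then u - v has excess w - v and Clarkson applies, and if v
    > w the term in u - v is bounded below by 0. *)
Let truncpow_avg_nonneg t tau u v : 2 <= t -> 0 <= tau -> 0 <= u -> 0 <= v ->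
  2 * truncpow t tau u + truncpow t tau v
  <= truncpow t tau (u + v) + truncpow t tau (u - v).
Proof.
move=> t2 tau0 u0 v0; have t0 : 0 < t by lra.
have [ut|tu] := leP u tau.
  rewrite {1}/truncpow ger0_norm// (max_idPr _) ?subr_le0//.
  rewrite powR0 ?gt_eqF// mulr0 add0r -[leLHS]addr0.
  apply: lerD; last exact: truncpow_ge0.
  by apply: ler_truncpow; rewrite ?ger0_norm ?addr_ge0// lerDr.
set w := u - tau; have w0 : 0 <= w by rewrite subr_ge0 ltW.
have -> : truncpow t tau u = w `^ t.
  by rewrite /truncpow ger0_norm// (max_idPl _).
have -> : truncpow t tau (u + v) = (w + v) `^ t.
  rewrite /truncpow ger0_norm ?addr_ge0// addrAC (max_idPl _)//.
  by rewrite addr_ge0.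
have vt : truncpow t tau v <= v `^ t by rewrite -[in leRHS](ger0_norm v0) truncpow_le.
have [vw|wv] := leP v w.
- have -> : truncpow t tau (u - v) = (w - v) `^ t.
    have uv : 0 <= u - v by move: vw; rewrite /w; lra.
    rewrite /truncpow ger0_norm// addrAC (max_idPl _)//.
    by rewrite subr_ge0.
  have := powR_clarkson t2 v0 vw; have := powR_ge0 v t.
  by lra.
- have := powR_addl_ge t2 w0 (ltW wv); have := truncpow_ge0 t tau (u - v).
  by lra.
Qed.

(* Applied to a symmetric noise x, this bounds from below the increase of the
   mean of [truncpow] caused by the shift th. *)
Lemma truncpow_avg t tau x th : 2 <= t -> 0 <= tau ->
  2 * truncpow t tau x + truncpow t tau th
  <= truncpow t tau (x + th) + truncpow t tau (x - th).
Proof.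
move=> t2 tau0.
wlog x0 : x / 0 <= x => [H|].
  have [|/ltW x0] := leP 0 x; first exact: H.
  have /H : 0 <= - x by rewrite oppr_ge0.
  rewrite truncpowN -[truncpow _ _ (- x + th)]truncpowN opprD opprK.
  by rewrite -[truncpow _ _ (- x - th)]truncpowN opprD !opprK [X in _ <= X -> _]addrC.
wlog th0 : th / 0 <= th => [H|].
  have [|/ltW th0] := leP 0 th; first exact: H.
  have /H : 0 <= - th by rewrite oppr_ge0.
  by rewrite truncpowN opprK [X in _ <= X -> _]addrC.
exact: truncpow_avg_nonneg.
Qed.

(** The excesses b and c of th and th + y over the threshold differ by at most |y|, so [powR_add_le]
    applies with either of them as the main term; the two resulting bounds control both signs of the
    difference. *)
Lemma truncpow_perturb t tau a th y : 0 < t -> 0 < a ->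
  0 <= tau ->
  (truncpow t tau (th + y) - truncpow t tau th) ^+ 2 <=
  2 * ((1 + a) `^ t - 1) ^+ 2 * `|th| `^ (2 * t)
  + 2 * ((1 + a^-1) `^ t) ^+ 2 * `|y| `^ (2 * t).
Proof.
move=> t0 a0 tau0.
set k := (1 + a) `^ t - 1; set C := (1 + a^-1) `^ t.
have k0 : 0 <= k.
  rewrite subr_ge0; apply: (@le_trans _ _ (1 `^ t)); first by rewrite powR1.
  by apply: ler_powR2r; [exact: ltW|exact: ler01|rewrite lerDl ltW].
have C0 : 0 <= C by exact: powR_ge0.
rewrite -!powR_sqr.
have : `|truncpow t tau (th + y) - truncpow t tau th|
    <= k * `|th| `^ t + C * `|y| `^ t; last first.
  set D := truncpow _ _ _ - _; set A := `|th| `^ t; set B := `|y| `^ t => H.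
  have H2 : D ^+ 2 <= (k * A + C * B) ^+ 2.
    rewrite -[leLHS](real_normK (num_real D)) ler_pXn2r// nnegrE.
    by rewrite addr_ge0// mulr_ge0// powR_ge0.
  have := sqr_ge0 (k * A - C * B); nra.
have m0 z : 0 <= Num.max z 0 :> R by rewrite le_max lexx orbT.
rewrite /truncpow; set b := Num.max (`|th| - tau) 0.
set c := Num.max (`|th + y| - tau) 0.
have b0 : 0 <= b := m0 _.
have c0 : 0 <= c := m0 _.
have cb : c <= b + `|y|.
  rewrite ge_max [X in _ && X]addr_ge0// andbT.
  have := ler_normD th y; have : `|th| - tau <= b by rewrite le_max lexx.
  by lra.
have bc : b <= c + `|y|.
  rewrite ge_max [X in _ && X]addr_ge0// andbT.
  have : `|th| <= `|th + y| + `|y| by rewrite -[in leLHS](addrK y th) ler_normB.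
  have : `|th + y| - tau <= c by rewrite le_max lexx.
  by lra.
have bth : b <= `|th| by rewrite ge_max normr_ge0 andbT gerBl.
have btht : b `^ t <= `|th| `^ t by apply: ler_powR2r => //; exact: ltW.
have kbth : k * b `^ t <= k * `|th| `^ t by rewrite ler_wpM2l.
have key z z' : 0 <= z -> z' <= z + `|y| -> 0 <= z' ->
    z' `^ t <= (k + 1) * z `^ t + C * `|y| `^ t.
  move=> z0 zz' z'0; rewrite /k subrK.
  apply: (le_trans (ler_powR2r (ltW t0) z'0 zz')).
  exact: powR_add_le.
rewrite ler_norml; apply/andP; split.
- have H := key c b c0 bc b0.
  have [lecb|ltbc] := leP c b.
    have : k * c `^ t <= k * b `^ t.
      by rewrite ler_wpM2l//; apply: ler_powR2r => //; exact: ltW.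
    by lra.
  have : b `^ t <= c `^ t by apply: ler_powR2r => //; exact: ltW.
  have : 0 <= C * `|y| `^ t by rewrite mulr_ge0// powR_ge0.
  have : 0 <= k * `|th| `^ t by rewrite mulr_ge0// powR_ge0.
  by lra.
- by have := key b c b0 cb c0; lra.
Qed.

Lemma measurable_truncpow t tau : measurable_fun setT (truncpow t tau).
Proof.
apply: (measurableT_comp (measurable_powR t)).
by apply: measurable_maxr => //; exact: measurable_funB.
Qed.

End truncated_power.

(** * Gaussian moments of the truncated power *)

Section centering.
Context {disp : measure_display} {T : measurableType disp} {R : realType}.
Local Open Scope ereal_scope.

(** The variance is the least second moment about a constant, so an explicit [c] can replace the
    mean: 0 under the null, the truncated power of the shift under the alternative. *)
Lemma integral_center_sqr (P : probability T R) (h : T -> R) (c V : R) :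
  measurable_fun setT h -> \int[P]_x ((h x - c) ^+ 2)%:E <= V%:E ->
  exists m : R, [/\ \int[P]_x (h x)%:E = m%:E, \int[P]_x (h x - m)%:E = 0 &
    \int[P]_x ((h x - m) ^+ 2)%:E <= V%:E].
Proof.
move=> mh hV.
have mhb (b : R) : measurable_fun setT (fun x => (h x - b)%R).
  exact: measurable_funB.
have ihc : P.-integrable setT (fun x => (h x - c)%:E).
  by apply: (integrable_of_sqr (h := fun x => (h x - c)%R)) => //;
    rewrite (le_lt_trans hV)// ltry.
have icst (b : R) : P.-integrable setT (fun=> b%:E).
  exact: finite_measure_integrable_cst.
have ih : P.-integrable setT (fun x => (h x)%:E).
  apply: (@eq_integrable _ _ _ _ _ measurableT (fun x => (h x - c)%:E + c%:E)).
    by move=> x _; rewrite -EFinD subrK.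
  exact: integrableD.
have ihc2 : P.-integrable setT (fun x => ((h x - c) ^+ 2)%:E).
  apply/integrableP; split.
    by apply/measurable_EFinP; exact: measurable_funX.
  under eq_integral do rewrite gee0_abs ?lee_fin ?sqr_ge0//.
  by rewrite (le_lt_trans hV)// ltry.
have hfin : \int[P]_x (h x)%:E \is a fin_num by exact: integrable_fin_num.
exists (fine (\int[P]_x (h x)%:E)); set m := fine _.
have hm : \int[P]_x (h x)%:E = m%:E by rewrite /m fineK.
have intB (b : R) : \int[P]_x (h x - b)%:E = (m - b)%:E.
  under eq_integral do rewrite EFinB.
  by rewrite integralB// hm integral_probability_cst.
split => //; first by rewrite intB subrr.
rewrite [leLHS](_ : _ =
  \int[P]_x (((h x - c) ^+ 2)%:E + ((2 * (c - m))%:E * (h x - c)%:E +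
     ((c - m) ^+ 2)%:E))); last first.
  apply: eq_integral => x _; rewrite -EFinM -!EFinD; congr (_%:E); ring.
rewrite integralD//; last by apply: integrableD => //; exact: integrableZl.
rewrite integralD//; last exact: integrableZl.
rewrite integralZl// intB integral_probability_cst.
apply: le_trans hV; rewrite -EFinM -EFinD -[leRHS]adde0 leeD2l// lee_fin.
by have := sqr_ge0 (c - m)%R; nra.
Qed.

End centering.

Section gaussian_truncpow.
Context (R : realType).
Implicit Types (t tau s th x : R).

(** The factor 2 counts the exponentials dominating exp(b |x|), the middle factor comes from
    [powR_le_expR], and exp(1/2) is what remains of the Gaussian exponent in
    [integral_truncpow_sqr]. *)
Definition moment_cst t : R := 2 * (2 * t) `^ (2 * t) * expR (2^-1).

Lemma moment_cst_gt0 t : 0 < t -> 0 < moment_cst t.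
Proof.
by move=> t0; rewrite !mulr_gt0 ?expR_gt0// powR_gt0// mulr_gt0.
Qed.

Let mexp (b : R) : measurable_fun setT (fun x : R => (expR (b * x))%:E).
Proof. by apply/measurable_EFinP; apply: measurableT_comp => //; exact: measurable_funM. Qed.

Let mtrunc2 t tau c th : measurable_fun setT
  (fun x : R => ((truncpow t tau (x + th) - c) ^+ 2)%:E).
Proof.
apply/measurable_EFinP; apply: measurable_funX; apply: measurable_funB => //.
apply: (measurableT_comp (measurable_truncpow t tau)).
exact: measurable_funD.
Qed.

(** For z = (|x| - tau) / s > 0, z^(2t) is at most a constant times exp(z) <= exp((a + 1) z) = exp(b
    |x| - a (a + 1)). The tilt b = (a + 1) / s is nearly optimal: after integration the exponent is
    -a^2/2 + 1/2, with a = tau / s. *)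
Lemma integral_truncpow_sqr t tau s : 0 < t -> 0 <= tau -> 0 < s ->
  (\int[normal_prob 0 s]_x ((truncpow t tau x) ^+ 2)%:E
   <= (moment_cst t * s `^ (2 * t) * expR (- (tau ^+ 2 / (2 * s ^+ 2))))%:E)%E.
Proof.
move=> t0 tau0 s0; have sn0 : s != 0 by rewrite gt_eqF.
set a := tau / s; have a0 : 0 <= a by rewrite divr_ge0// ltW.
set b := (a + 1) / s; have b0 : 0 <= b by rewrite divr_ge0 ?addr_ge0// ltW.
set K := s `^ (2 * t) * (2 * t) `^ (2 * t) * expR (- (a * (a + 1))).
have K0 : 0 <= K by rewrite !mulr_ge0 ?expR_ge0 ?powR_ge0.
have pw x : truncpow t tau x ^+ 2 <= K * (expR (b * x) + expR (- b * x)).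
  rewrite /truncpow powR_sqr.
  have rhs0 : 0 <= K * (expR (b * x) + expR (- b * x)).
    by rewrite mulr_ge0// addr_ge0// expR_ge0.
  have [m0|m0] := leP (`|x| - tau) 0; first by rewrite powR0// gt_eqF// mulr_gt0.
  set z := (`|x| - tau) / s.
  have z0 : 0 <= z by rewrite divr_ge0// ltW.
  have -> : `|x| - tau = s * z by rewrite /z mulrCA divff// mulr1.
  rewrite powRM//; last exact: ltW.
  apply: (@le_trans _ _ (s `^ (2 * t) * ((2 * t) `^ (2 * t) * expR z))).
    by rewrite ler_wpM2l ?powR_ge0// powR_le_expR// mulr_gt0.
  rewrite mulrA /K -[leRHS]mulrA ler_wpM2l ?mulr_ge0 ?powR_ge0//.
  apply: (@le_trans _ _ (expR (- (a * (a + 1))) * expR (b * `|x|))).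
    rewrite -expRD ler_expR.
    have -> : - (a * (a + 1)) + b * `|x| = (a + 1) * z.
      by rewrite /b /z /a; field.
    by rewrite mulrDl mul1r lerDr mulr_ge0.
  rewrite ler_wpM2l ?expR_ge0//.
  have [x0|x0] := leP 0 x.
    by rewrite (ger0_norm x0) lerDl expR_ge0.
  by rewrite (ltr0_norm x0) mulrN -mulNr lerDr expR_ge0.
have mexpD := emeasurable_funD (mexp b) (mexp (- b)).
apply: (@le_trans _ _ (\int[normal_prob 0 s]_x
   (K%:E * ((expR (b * x))%:E + (expR (- b * x))%:E)))%E).
  apply: ge0_le_integral => //.
  - by move=> x _; rewrite lee_fin sqr_ge0.
  - apply/measurable_EFinP; apply: measurable_funX; exact: measurable_truncpow.
  - by apply: emeasurable_funM => //.
  - by move=> x _; rewrite -EFinD -EFinM lee_fin.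
have -> : (\int[normal_prob 0 s]_x
    (K%:E * ((expR (b * x))%:E + (expR (- b * x))%:E)) =
  K%:E * \int[normal_prob 0 s]_x ((expR (b * x))%:E + (expR (- b * x))%:E))%E.
  apply: ge0_integralZl => // x _.
  by rewrite -EFinD lee_fin addr_ge0// expR_ge0.
have -> : (\int[normal_prob 0 s]_x ((expR (b * x))%:E + (expR (- b * x))%:E) =
  \int[normal_prob 0 s]_x (expR (b * x))%:E +
  \int[normal_prob 0 s]_x (expR (- b * x))%:E)%E.
  by apply: ge0_integralD => //; try (by move=> x _; rewrite lee_fin expR_ge0);
    exact: mexp.
rewrite (integral_expR_normal b sn0) (integral_expR_normal (- b) sn0).
rewrite -EFinD -EFinM lee_fin sqrrN /K /moment_cst.
have E : expR (- (a * (a + 1))) * expR (b ^+ 2 * s ^+ 2 / 2) =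
   expR 2^-1 * expR (- (tau ^+ 2 / (2 * s ^+ 2))).
  by rewrite -!expRD; congr expR; rewrite /b /a; field.
set e1 := expR (- (a * _)) in E *; set e2 := expR (b ^+ 2 * _ / 2) in E *.
set e3 := expR _ in E *; set e4 := expR _ in E *.
rewrite [leRHS](_ : _ = 2 * (2 * t) `^ (2 * t) * s `^ (2 * t) * (e3 * e4)); last by ring.
by rewrite -E le_eqVlt; apply/orP; left; apply/eqP; ring.
Qed.

Lemma integral_norm_powR t s : 0 < t -> 0 < s ->
  (\int[normal_prob 0 s]_x (`|x| `^ (2 * t))%:E
   <= (moment_cst t * s `^ (2 * t))%:E)%E.
Proof.
move=> t0 s0; have := integral_truncpow_sqr t0 (lexx 0) s0.
rewrite expr0n/= mul0r oppr0 expR0 mulr1; apply: le_trans.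
rewrite le_eqVlt; apply/orP; left; apply/eqP; apply: eq_integral => x _.
by rewrite /truncpow subr0 (max_idPl _)// powR_sqr.
Qed.

Lemma integral_truncpow_shift t tau a s th : 0 < t -> 0 < a -> 0 <= tau ->
  0 < s ->
  (\int[normal_prob th s]_x ((truncpow t tau x - truncpow t tau th) ^+ 2)%:E
   <= (2 * ((1 + a) `^ t - 1) ^+ 2 * `|th| `^ (2 * t)
     + 2 * ((1 + a^-1) `^ t) ^+ 2 * (moment_cst t * s `^ (2 * t)))%:E)%E.
Proof.
move=> t0 a0 tau0 s0; have sn0 : s != 0 by rewrite gt_eqF.
have mg : measurable_fun setT
    (fun x : R => ((truncpow t tau x - truncpow t tau th) ^+ 2)%:E).
  apply/measurable_EFinP; apply: measurable_funX; apply: measurable_funB => //.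
  exact: measurable_truncpow.
rewrite (ge0_integral_normal_shift th sn0 mg); last first.
  by move=> x; rewrite lee_fin sqr_ge0.
set A := 2 * _ ^+ 2 * _; set B := 2 * _ ^+ 2.
have A0 : 0 <= A.
  by apply: mulr_ge0; [apply: mulr_ge0 => //; exact: sqr_ge0|exact: powR_ge0].
have B0 : 0 <= B by apply: mulr_ge0 => //; exact: sqr_ge0.
have mp : measurable_fun setT (fun x : R => (`|x| `^ (2 * t))%:E).
  apply/measurable_EFinP; exact: (measurableT_comp (measurable_powR _)).
apply: (@le_trans _ _ (\int[normal_prob 0 s]_x
   (A%:E + B%:E * (`|x| `^ (2 * t))%:E))%E).
  apply: ge0_le_integral => //.
  - by move=> x _; rewrite lee_fin sqr_ge0.
  - exact: mtrunc2.
  - by apply: emeasurable_funD => //; exact: emeasurable_funM.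
  - by move=> x _; rewrite -EFinM -EFinD lee_fin (addrC x); exact: truncpow_perturb.
have -> : (\int[normal_prob 0 s]_x (A%:E + B%:E * (`|x| `^ (2 * t))%:E) =
  \int[normal_prob 0 s]_x A%:E +
  \int[normal_prob 0 s]_x (B%:E * (`|x| `^ (2 * t))%:E))%E.
  apply: ge0_integralD => //.
  - by move=> x _; rewrite -EFinM lee_fin mulr_ge0// powR_ge0.
  - exact: emeasurable_funM.
have -> : (\int[normal_prob 0 s]_x (B%:E * (`|x| `^ (2 * t))%:E) =
  B%:E * \int[normal_prob 0 s]_x (`|x| `^ (2 * t))%:E)%E.
  by apply: ge0_integralZl => // x _; rewrite lee_fin powR_ge0.
rewrite integral_probability_cst EFinD leeD2l//.
by rewrite [leRHS]EFinM; apply: lee_wpmul2l; [rewrite lee_fin|exact: integral_norm_powR].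
Qed.

(** For symmetric noise [P] shifted to [Q], the mean under [Q] is that of either translate by th or
    - th, and [truncpow_avg] applies pointwise to their sum. The form with factor 2 avoids
    subtraction in [\bar R]. *)
Let truncpow_mean_gap_symmetric (P Q : probability (measurableTypeR R) R) t tau th :
  2 <= t -> 0 <= tau ->
  (\int[Q]_x (truncpow t tau x)%:E = \int[P]_x (truncpow t tau (x + th))%:E)%E ->
  (\int[Q]_x (truncpow t tau x)%:E = \int[P]_x (truncpow t tau (x - th))%:E)%E ->
  (2%:E * \int[P]_x (truncpow t tau x)%:E + (truncpow t tau th)%:E
   <= 2%:E * \int[Q]_x (truncpow t tau x)%:E)%E.
Proof.
move=> t2 tau0 shiftE flipE.
have mg : measurable_fun setT (fun x : R => (truncpow t tau x)%:E).
  by apply/measurable_EFinP; exact: measurable_truncpow.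
have g0 (x : R) : (0 <= (truncpow t tau x)%:E)%E.
  by rewrite lee_fin truncpow_ge0.
have mgb b : measurable_fun setT (fun x : R => (truncpow t tau (x + b))%:E).
  apply/measurable_EFinP; apply: (measurableT_comp (measurable_truncpow t tau)).
  exact: measurable_funD.
have m2 : measurable_fun setT (fun x : R => 2%:E * (truncpow t tau x)%:E)%E.
  exact: emeasurable_funM.
have -> : (2%:E * \int[Q]_x (truncpow t tau x)%:E =
    \int[P]_x ((truncpow t tau (x + th))%:E + (truncpow t tau (x - th))%:E))%E.
  rewrite ge0_integralD//; [|exact: mgb|exact: (mgb (- th))].
  rewrite -shiftE -flipE -[2]/(1 + 1 : R) EFinD ge0_muleDl ?mul1e//.
have -> : (2%:E * \int[P]_x (truncpow t tau x)%:E + (truncpow t tau th)%:E =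
    \int[P]_x (2%:E * (truncpow t tau x)%:E + (truncpow t tau th)%:E))%E.
  rewrite ge0_integralD//; last by move=> x _; rewrite mule_ge0.
  by rewrite integral_probability_cst ge0_integralZl.
apply: ge0_le_integral => //.
- by move=> x _; rewrite adde_ge0// mule_ge0.
- exact: emeasurable_funD.
- apply: emeasurable_funD; [exact: mgb|exact: (mgb (- th))].
- by move=> x _; rewrite -EFinM -!EFinD lee_fin truncpow_avg.
Qed.

Lemma integral_truncpow_mean_gap t tau s th : 2 <= t -> 0 <= tau -> 0 < s ->
  (2%:E * \int[normal_prob 0 s]_x (truncpow t tau x)%:E + (truncpow t tau th)%:E
   <= 2%:E * \int[normal_prob th s]_x (truncpow t tau x)%:E)%E.
Proof.
move=> t2 tau0 s0; have sn0 : s != 0 by rewrite gt_eqF.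
have mg : measurable_fun setT (fun x : R => (truncpow t tau x)%:E).
  by apply/measurable_EFinP; exact: measurable_truncpow.
have g0 (x : R) : (0 <= (truncpow t tau x)%:E)%E.
  by rewrite lee_fin truncpow_ge0.
have mgb b : measurable_fun setT (fun x : R => (truncpow t tau (x + b))%:E).
  apply/measurable_EFinP; apply: (measurableT_comp (measurable_truncpow t tau)).
  exact: measurable_funD.
have shiftE := ge0_integral_normal_shift th sn0 mg g0.
apply: (truncpow_mean_gap_symmetric t2 tau0 shiftE).
apply: (etrans shiftE).
apply: (etrans (esym (@ge0_integral_normal_opp R s
  (fun x => (truncpow t tau (x + th))%:E) sn0 (mgb th) (fun x => g0 (x + th))))).
by apply: eq_integral => x _; rewrite -[in RHS]truncpowN opprB addrC.
Qed.

End gaussian_truncpow.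

(** * Upper bound on the minimax risk *)

Section truncated_statistic.
Context (R : realType).
Implicit Types (t tau a : R).

(** [fine] would send an infinite mean to 0; [truncmean_center] excludes this as soon as some second
    moment is finite. *)
Definition truncmean t tau (th s : R) : R :=
  fine (\int[normal_prob th s]_x (truncpow t tau x)%:E).

Lemma truncmean_center t tau (th s c V : R) :
  (\int[normal_prob th s]_x ((truncpow t tau x - c) ^+ 2)%:E <= V%:E)%E ->
  [/\ (\int[normal_prob th s]_x (truncpow t tau x)%:E
        = (truncmean t tau th s)%:E)%E,
      (\int[normal_prob th s]_x (truncpow t tau x - truncmean t tau th s)%:E
        = 0)%E &
      (\int[normal_prob th s]_x
        ((truncpow t tau x - truncmean t tau th s) ^+ 2)%:E <= V%:E)%E].
Proof.
move=> H; have [m [mE m0 mV]] :=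
  @integral_center_sqr _ _ _ (normal_prob th s) _ c V (measurable_truncpow t tau) H.
have e : truncmean t tau th s = m by rewrite /truncmean mE.
by split; rewrite e.
Qed.

(** Centred under theta, so that one Chebyshev bound serves both hypotheses. The test uses the
    centring at 0; the two centrings differ by the mean gap. *)
Definition truncstat d t tau (theta : d.-tuple R) (sigma : 'I_d -> R)
    (x : d.-tuple (measurableTypeR R)) : R :=
  \sum_(j < d) (truncpow t tau (tnth x j)
                - truncmean t tau (tnth theta j) (sigma j)).

Lemma measurable_truncstat d t tau (theta : d.-tuple R) sigma :
  measurable_fun setT (truncstat t tau theta sigma).
Proof.
apply: measurable_sum => j; apply: measurable_funB => //.
apply: (measurableT_comp (measurable_truncpow t tau)).
exact: measurable_tnth.
Qed.

Lemma truncstat_chebyshev d t tau (theta : d.-tuple R) (sigma : 'I_d -> R)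
    (v : 'I_d -> R) a :
  (forall j, exists c, (\int[normal_prob (tnth theta j) (sigma j)]_x
     ((truncpow t tau x - c) ^+ 2)%:E <= (v j)%:E)%E) ->
  0 < a ->
  (gauss sigma theta [set x | (a <= `|truncstat t tau theta sigma x|)%R]
   <= ((\sum_(j < d) v j) / a ^+ 2)%:E)%E.
Proof.
move=> hv a0; apply: chebyshev_sqr => //; first exact: measurable_truncstat.
apply: (@integral_sum_sqr_product_prob _ (measurableTypeR R) R d
  (fun j => normal_prob (tnth theta j) (sigma j))
  (fun j x => truncpow t tau x - truncmean t tau (tnth theta j) (sigma j))).
- by move=> j; apply: measurable_funB => //; exact: measurable_truncpow.
- by move=> j; have [c /truncmean_center[]] := hv j.
- by move=> j; have [c /truncmean_center[]] := hv j.
Qed.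

End truncated_statistic.

Section finite_sums.
Context (R : realType).

Lemma sum_sqr_le_sqr_sum (I : finType) (P : pred I) (f : I -> R) :
  (forall i, 0 <= f i) ->
  \sum_(i | P i) f i ^+ 2 <= (\sum_(i | P i) f i) ^+ 2.
Proof.
move=> f0; rewrite [leRHS]expr2 mulr_suml; apply: ler_sum => i Pi.
rewrite expr2 ler_wpM2l// (bigD1 i)//= lerDl.
exact: sumr_ge0.
Qed.

Lemma sum_support_le d (theta : d.-tuple R) (s : nat) (c : R) : 0 <= c ->
  (norm_0 theta <= s)%N ->
  \sum_(j < d | tnth theta j != 0) c <= s%:R * c.
Proof.
move=> c0 hs; rewrite big_const iter_addr_0 -[leLHS]mulr_natl ler_wpM2r// ler_nat.
exact: hs.
Qed.

End finite_sums.

Section upper_bound.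
Context (R : realType) (eta t : R).
Hypotheses (eta0 : 0 < eta) (t2 : 2 <= t).

Let t0 : 0 < t. Proof. by rewrite (lt_le_trans _ t2). Qed.

Section upper_fixed_problem.
Context (d : nat) (sigma : 'I_d -> R) (s : nat) (lam nu : R).
Hypotheses (sigma0 : forall j, 0 < sigma j) (lam0 : 0 <= lam).
Hypothesis nuE : nu ^+ 2 =
  \sum_(j < d) sigma j `^ (2 * t) * expR (- lam ^+ 2 / sigma j ^+ 2).
Hypothesis (nu0 : 0 < nu).

(** The factor sqrt 2 turns tau^2 / (2 sigma_j^2) into lam^2 / sigma_j^2, so the null second moments
    are bounded by multiples of the summands of nu^2. In this section [nu] stands for the quantity
    nu^t of the statement. *)
Let tau := Num.sqrt 2 * lam.
Let tau0 : 0 <= tau. Proof. by rewrite mulr_ge0// sqrtr_ge0. Qed.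
Let M := lam `^ t * s%:R + nu.
Let M0 : 0 < M.
Proof. by rewrite ltr_wpDl// mulr_ge0// powR_ge0. Qed.
Let nuM : nu <= M.
Proof. by rewrite lerDr mulr_ge0// powR_ge0. Qed.
Let lamM : lam `^ t * s%:R <= M.
Proof. by rewrite lerDl ltW. Qed.

Let v0 j := moment_cst t * (sigma j `^ (2 * t) * expR (- lam ^+ 2 / sigma j ^+ 2)).

Let v0_ge0 j : 0 <= v0 j.
Proof.
apply: mulr_ge0; first by rewrite ltW// moment_cst_gt0.
by rewrite mulr_ge0 ?powR_ge0 ?expR_ge0.
Qed.

Let v0P j : (\int[normal_prob 0 (sigma j)]_x ((truncpow t tau x - 0) ^+ 2)%:E
   <= (v0 j)%:E)%E.
Proof.
under eq_integral do rewrite subr0.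
apply: le_trans (integral_truncpow_sqr t0 tau0 (sigma0 j)) _.
rewrite lee_fin /v0 mulrA le_eqVlt; apply/orP; left; apply/eqP.
congr (_ * expR _); rewrite /tau exprMn sqr_sqrtr//.
by field; rewrite gt_eqF.
Qed.

Lemma truncstat_null_level L : 0 < L ->
  (gauss sigma (nseq_tuple d 0%R)
     [set x | (L * M <= `|truncstat t tau (nseq_tuple d 0%R) sigma x|)%R]
   <= (moment_cst t / L ^+ 2)%:E)%E.
Proof.
move=> L0; apply: le_trans (truncstat_chebyshev (v := v0) _ _) _.
- by move=> j; exists 0; rewrite tnth_nseq; exact: v0P.
- exact: mulr_gt0.
rewrite lee_fin -mulr_sumr -nuE exprMn -mulrA ler_wpM2l//.
  by rewrite ltW// moment_cst_gt0.
rewrite invfM mulrCA ler_piMr ?invr_ge0 ?sqr_ge0//.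
by rewrite ler_pdivrMr ?exprn_gt0// mul1r ler_pXn2r// nnegrE ltW.
Qed.

(** Charges the noise on the support to the rate: where sigma_j > lam, the weight exp(- lam^2 /
    sigma_j^2) is at least 1/e. *)
Let sigma_pow_le j : sigma j `^ (2 * t) <=
  lam `^ (2 * t) + expR 1 * (sigma j `^ (2 * t) * expR (- lam ^+ 2 / sigma j ^+ 2)).
Proof.
have [le_sl|lt_ls] := leP (sigma j) lam.
  rewrite -[leLHS]addr0 lerD//; last by rewrite !mulr_ge0 ?expR_ge0 ?powR_ge0.
  by apply: ler_powR2r => //; rewrite ?mulr_ge0// ltW.
rewrite -[leLHS]add0r lerD ?powR_ge0// mulrCA -expRD ler_peMr ?powR_ge0//.
rewrite -[leLHS]expR0 ler_expR mulNr subr_ge0 ler_pdivrMr ?exprn_gt0// mul1r.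
by rewrite ler_pXn2r ?nnegrE// ltW.
Qed.

(** The null bound [v0] is kept on every coordinate and sums to a multiple of nu^2; only the at most
    s coordinates of the support add a perturbation term. *)
Lemma truncstat_alt_variance (theta : d.-tuple R) a : 0 < a ->
  (norm_0 theta <= s)%N ->
  exists2 v : 'I_d -> R,
   (forall j, exists c, (\int[normal_prob (tnth theta j) (sigma j)]_x
     ((truncpow t tau x - c) ^+ 2)%:E <= (v j)%:E)%E) &
   \sum_(j < d) v j <=
     2 * ((1 + a) `^ t - 1) ^+ 2 * (\sum_(j < d) `|tnth theta j| `^ t) ^+ 2
     + (moment_cst t + 2 * ((1 + a^-1) `^ t) ^+ 2 * moment_cst t * (1 + expR 1))
       * M ^+ 2.
Proof.
move=> a0 hs; have mc0 := moment_cst_gt0 t0.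
set k := 2 * _ ^+ 2; set B := 2 * _ ^+ 2.
have k0 : 0 <= k by apply: mulr_ge0 => //; exact: sqr_ge0.
have B0 : 0 <= B by apply: mulr_ge0 => //; exact: sqr_ge0.
exists (fun j => v0 j + (if tnth theta j == 0 then 0 else
   k * `|tnth theta j| `^ (2 * t) + B * (moment_cst t * sigma j `^ (2 * t)))).
  move=> j; case: eqP => [->|_].
    by exists 0; rewrite addr0; exact: v0P.
  exists (truncpow t tau (tnth theta j)).
  apply: le_trans (integral_truncpow_shift _ t0 a0 tau0 (sigma0 j)) _.
  by rewrite lee_fin lerDr; exact: v0_ge0.
rewrite big_split/= -mulr_sumr -nuE (mulrDl (moment_cst t)) addrCA lerD//.
  by rewrite ler_wpM2l ?(ltW mc0)// ler_pXn2r// nnegrE ltW.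
under eq_bigr do rewrite -if_neg.
rewrite -big_mkcond/= big_split/= lerD//.
  rewrite -mulr_sumr ler_wpM2l//.
  apply: le_trans (_ : \sum_(j < d | tnth theta j != 0) (`|tnth theta j| `^ t) ^+ 2 <= _).
    by rewrite le_eqVlt; apply/orP; left; apply/eqP/eq_bigr => j _; rewrite powR_sqr.
  apply: le_trans (sum_sqr_le_sqr_sum _ _) _; first by move=> j; exact: powR_ge0.
  rewrite ler_pXn2r ?nnegrE ?sumr_ge0//; try by move=> j _; exact: powR_ge0.
  rewrite [leLHS]big_mkcond/=; apply: ler_sum => j _.
  by case: ifP => // _; exact: powR_ge0.
rewrite -mulr_sumr -mulr_sumr -[leRHS]mulrA -[leRHS]mulrA.
rewrite ler_wpM2l// ler_wpM2l ?(ltW mc0)//.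
apply: (@le_trans _ _ (\sum_(j < d | tnth theta j != 0) lam `^ (2 * t) +
   expR 1 * nu ^+ 2)).
  rewrite nuE mulr_sumr; apply: (le_trans (ler_sum _ (fun j _ => sigma_pow_le j))).
  rewrite big_split/= lerD2l big_mkcond/=; apply: ler_sum => j _.
  by case: ifP => // _; rewrite !mulr_ge0 ?expR_ge0 ?powR_ge0.
(* For the integer s this turns s copies of lam^(2t) into (lam^t s)^2. *)
have s1 : s%:R <= s%:R ^+ 2 :> R.
  by rewrite -natrX ler_nat; case: (s) => // n; rewrite leq_pmulr.
have lt0 := powR_ge0 lam (2 * t).
have : \sum_(j < d | tnth theta j != 0) lam `^ (2 * t) <= (lam `^ t * s%:R) ^+ 2.
  apply: le_trans (sum_support_le lt0 hs) _.
  by rewrite exprMn powR_sqr mulrC ler_wpM2l.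
have : (lam `^ t * s%:R) ^+ 2 <= M ^+ 2.
  by rewrite ler_pXn2r ?nnegrE ?mulr_ge0 ?powR_ge0// ltW.
have : expR 1 * nu ^+ 2 <= expR 1 * M ^+ 2.
  by rewrite ler_wpM2l ?expR_ge0// ler_pXn2r ?nnegrE// ltW.
by rewrite mulrDl mul1r; lra.
Qed.

Let ereal_avg_gap (x y : \bar R) (a b c : R) :
  x = a%:E -> y = b%:E -> (2%:E * x + c%:E <= 2%:E * y)%E -> c / 2 <= b - a.
Proof. by move=> -> ->; rewrite -!EFinM -EFinD lee_fin; lra. Qed.

Lemma truncstat_mean_gap (theta : d.-tuple R) :
  (norm_0 theta <= s)%N ->
  (2 `^ t)^-1 / 2 * (\sum_(j < d) `|tnth theta j| `^ t) - 2 `^ t * M <=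
  \sum_(j < d) (truncmean t tau (tnth theta j) (sigma j)
                - truncmean t tau 0 (sigma j)).
Proof.
move=> hs; set D := \sum_(j < d) `|_| `^ t.
have p0 : 0 < 2 `^ t :> R by rewrite powR_gt0.
have gap j : truncpow t tau (tnth theta j) / 2 <=
    truncmean t tau (tnth theta j) (sigma j) - truncmean t tau 0 (sigma j).
  have [E0 _ _] := truncmean_center (v0P j).
  have [E1 _ _] := truncmean_center
    (integral_truncpow_shift (tnth theta j) t0 ltr01 tau0 (sigma0 j)).
  apply: (ereal_avg_gap E0 E1).
  exact: (integral_truncpow_mean_gap (tnth theta j) t2 tau0 (sigma0 j)).
apply: le_trans (ler_sum _ (fun j _ => gap j)).
(* Truncation loses tau^t on at most s coordinates, and sqrt 2 <= 2. *)
have tauM : s%:R * tau `^ t <= 2 `^ t * M.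
  rewrite /tau powRM ?sqrtr_ge0// mulrC -mulrA.
  apply: ler_pM; rewrite ?mulr_ge0 ?powR_ge0//.
  apply: ler_powR2r; [exact: ltW|exact: sqrtr_ge0|].
  by rewrite -[leRHS]ger0_norm// -sqrtr_sqr ler_sqrt//; lra.
have : (2 `^ t)^-1 * D <= \sum_(j < d) truncpow t tau (tnth theta j) + 2 `^ t * M.
  apply: le_trans (_ : \sum_(j < d | tnth theta j != 0)
     (truncpow t tau (tnth theta j) + tau `^ t) <= _).
    rewrite mulr_sumr [leRHS]big_mkcond/=; apply: ler_sum => j _.
    case: eqP => [->|_] /=; first by rewrite normr0 powR0 ?mulr0// gt_eqF.
    by rewrite mulrC ler_pdivrMr// mulrC truncpow_ge.
  rewrite big_split/= lerD//.
    rewrite big_mkcond/=; apply: ler_sum => j _.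
    by case: ifP => // _; exact: truncpow_ge0.
  by apply: le_trans (sum_support_le (powR_ge0 _ _) hs) _.
rewrite -mulr_suml.
have : 0 <= 2 `^ t * M by rewrite mulr_ge0// ltW.
by lra.
Qed.

End upper_fixed_problem.
End upper_bound.

Section minimax_upper.
Context (R : realType).
Implicit Types (eta t eps : R).

Lemma norm_t_powR_ge d t eps (theta : d.-tuple R) : 0 < t -> 0 <= eps ->
  eps <= norm_t t theta -> eps `^ t <= \sum_(j < d) `|tnth theta j| `^ t.
Proof.
move=> t0 e0 /(ler_powR2r (ltW t0) e0) /le_trans; apply.
rewrite /norm_t -powRrM mulVf ?gt_eqF// powRr1//.
by apply: sumr_ge0 => j _; exact: powR_ge0.
Qed.

Theorem minimax_risk_upper eta t : 0 < eta -> 2 <= t ->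
  exists2 C : R, 0 < C & forall d (sigma : 'I_d -> R) (s : nat) (lam nu eps : R),
    (forall j, 0 < sigma j) -> 0 <= lam -> 0 < nu ->
    nu ^+ 2 = \sum_(j < d) sigma j `^ (2 * t) * expR (- lam ^+ 2 / sigma j ^+ 2) ->
    0 < eps -> C * (lam `^ t * s%:R + nu) <= eps `^ t ->
    (minimax_risk eps s t sigma <= eta%:E)%E.
Proof.
move=> eta0 t2; have t0 : 0 < t by rewrite (lt_le_trans _ t2).
have mc0 := moment_cst_gt0 t0; set mc := moment_cst t in mc0 *.
set p : R := 2 `^ t; have p0 : 0 < p by rewrite powR_gt0.
(* With D = ||theta||_t^t the mean gap is at least 2 q D - p M. One q D pays for p M and the
   threshold L M; the other is the deviation left to Chebyshev. *)
set q := p^-1 / 4; have q0 : 0 < q by rewrite divr_gt0// invr_gt0.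
(* Makes the error under the null at most eta / 2. *)
set L := Num.sqrt (2 * mc / eta).
have L20 : 0 < 2 * mc / eta by rewrite divr_gt0// mulr_gt0.
have L0 : 0 < L by rewrite sqrtr_gt0.
have mcL : mc / L ^+ 2 = eta / 2.
  by rewrite sqr_sqrtr ?(ltW L20)//; field; rewrite !gt_eqF.
(* The part of the variance growing with theta is 2 k^2 D^2 = (eta / 4) (q D)^2; [a] is then solved
   from (1 + a)^t - 1 = k. *)
set k := Num.sqrt (eta * q ^+ 2 / 8).
have k20 : 0 < eta * q ^+ 2 / 8 by rewrite divr_gt0// mulr_gt0// exprn_gt0.
have k0 : 0 < k by rewrite sqrtr_gt0.
have kE : k ^+ 2 = eta * q ^+ 2 / 8 by rewrite sqr_sqrtr ?(ltW k20).
set a := (1 + k) `^ t^-1 - 1.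
have a0 : 0 < a.
  rewrite subr_gt0; apply: (@le_lt_trans _ _ (1 `^ t^-1)); first by rewrite powR1.
  apply: gt0_ltr_powR; rewrite ?invr_gt0 ?nnegrE ?addr_ge0 ?(ltW k0)//.
  by rewrite ltrDl.
have aE : (1 + a) `^ t - 1 = k.
  rewrite (_ : 1 + a = (1 + k) `^ t^-1); last by rewrite /a; ring.
  by rewrite -powRrM mulVf ?gt_eqF// powRr1 ?addr_ge0 ?(ltW k0)//; ring.
set B := mc + 2 * ((1 + a^-1) `^ t) ^+ 2 * mc * (1 + expR 1).
have B0 : 0 < B.
  rewrite ltr_pwDl//; apply: mulr_ge0; last by rewrite addr_ge0// expR_ge0.
  apply: mulr_ge0; last exact: ltW.
  by apply: mulr_ge0 => //; exact: sqr_ge0.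
(* With r M <= D, the remaining variance B M^2 is also at most (eta / 4) (q D)^2. *)
set r := Num.sqrt (4 * B / (eta * q ^+ 2)).
have r20 : 0 < 4 * B / (eta * q ^+ 2) by apply: divr_gt0; apply: mulr_gt0 => //; exact: exprn_gt0.
have r0 : 0 < r by rewrite sqrtr_gt0.
have rE : r ^+ 2 = 4 * B / (eta * q ^+ 2) by rewrite sqr_sqrtr ?(ltW r20).
have pL0 : 0 < (p + L) / q by rewrite divr_gt0// addr_gt0.
exists ((p + L) / q + r); first by rewrite addr_gt0.
move=> d sigma s lam nu eps sigma0 lam0 nu0 nuE eps0.
set M := lam `^ t * s%:R + nu => hM.
have M0 : 0 < M by rewrite ltr_wpDl// mulr_ge0// powR_ge0.
set tau := Num.sqrt 2 * lam.
pose T0 := truncstat t tau (nseq_tuple d 0%R) sigma.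
pose psi x := L * M < T0 x.
have mpsi : measurable_fun setT psi.
  by apply: measurable_fun_ltr => //; exact: measurable_truncstat.
apply: (@le_trans _ _ (risk psi eps s t sigma)).
  by apply: ereal_inf_lbound; exists psi.
have -> : eta%:E = ((eta / 2)%:E + (eta / 2)%:E)%E.
  by rewrite -EFinD -splitr.
have mT th : measurable_fun setT (truncstat t tau th sigma).
  exact: measurable_truncstat.
have mset (P : d.-tuple (measurableTypeR R) -> bool) b : measurable_fun setT P ->
    measurable [set x | P x = b].
  by move=> mP; rewrite -[X in measurable X]setTI; exact: (mP measurableT [set b]).
have mabs th c : measurable [set x | (c <= `|truncstat t tau th sigma x|)%R].
  rewrite -[X in measurable X]setTI.
  apply: (@measurable_fun_ler _ _ _ setT (cst c)
    (fun x => `|truncstat t tau th sigma x|)) => //.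
  exact: measurableT_comp.
apply: leeD.
  rewrite -mcL; apply: le_trans (truncstat_null_level t2 s sigma0 lam0 nuE nu0 L0).
  apply: le_measure; rewrite ?inE//; first exact: mset.
  move=> x /= psix; apply: le_trans (ler_norm _).
  exact: ltW.
apply: ge_ereal_sup => _ [theta [hth hs] <-].
set D := \sum_(j < d) `|tnth theta j| `^ t.
have DM : ((p + L) / q + r) * M <= D.
  by apply: (le_trans hM); apply: norm_t_powR_ge => //; exact: ltW.
have D0 : 0 < D by apply: lt_le_trans DM; rewrite mulr_gt0// addr_gt0.
have DM1 : (p + L) * M <= q * D.
  rewrite mulrC -[leRHS]mulrC -ler_pdivrMr// mulrC -mulrA [M / q]mulrC mulrA.
  by apply: le_trans DM; rewrite ler_wpM2r// ?(ltW M0)// lerDl ltW.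
have DM2 : r * M <= D.
  by apply: le_trans DM; rewrite ler_wpM2r ?(ltW M0)// lerDr ltW.
have qD0 : 0 < q * D by rewrite mulr_gt0.
have [v hv vle] := truncstat_alt_variance t2 sigma0 lam0 nuE nu0 a0 hs.
apply: (@le_trans _ _ ((\sum_(j < d) v j) / (q * D) ^+ 2)%:E).
  apply: le_trans (truncstat_chebyshev hv qD0).
  apply: le_measure; rewrite ?inE//; first exact: mset.
  move=> x /= /negbT; rewrite /psi -leNgt => T0le.
  have subrKA' (u m m0 : R) : u - m0 = u - m + (m - m0) by ring.
  have T0E : T0 x = truncstat t tau theta sigma x +
      \sum_(j < d) (truncmean t tau (tnth theta j) (sigma j)
                    - truncmean t tau 0 (sigma j)).
    rewrite /T0 /truncstat -big_split/=; apply: eq_bigr => j _.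
    by rewrite tnth_nseq; exact: subrKA'.
  have gap := truncstat_mean_gap t2 sigma0 lam0 nu0 hs.
  rewrite ler_normr; apply/orP; right.
  have : p^-1 / 2 * D = 2 * (q * D) by rewrite /q; field; rewrite gt_eqF.
  move: gap T0le; rewrite T0E -/tau -/p -/M -/D.
  by move: DM1; clear; lra.
rewrite lee_fin ler_pdivrMr ?exprn_gt0//; apply: (le_trans vle).
rewrite -/mc -/B -/M -/D aE.
have -> : 2 * k ^+ 2 * D ^+ 2 = eta / 4 * (q * D) ^+ 2 by rewrite kE; field.
have : B * M ^+ 2 <= eta / 4 * (q * D) ^+ 2.
  have -> : B * M ^+ 2 = eta / 4 * q ^+ 2 * (r * M) ^+ 2.
    by rewrite [(r * M) ^+ 2]exprMn rE; field; rewrite !gt_eqF.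
  rewrite [(q * D) ^+ 2]exprMn -[leLHS]mulrA.
  apply: ler_wpM2l; first by rewrite divr_ge0// ltW.
  apply: ler_wpM2l; first exact: sqr_ge0.
  by rewrite ler_pXn2r ?nnegrE// ltW// mulr_gt0.
by set X := (q * D) ^+ 2; clear; lra.
Qed.

End minimax_upper.

(** * Lower bounds from finite priors *)

Section mixture_testing.
Context {disp : measure_display} {T : measurableType disp} {R : realType}.
Variables (I : finType) (P : probability T R) (Q : I -> probability T R).
Variables (f : I -> T -> R) (w : I -> R) (G : I -> I -> R) (delta : R).
Hypotheses (mf : forall k, measurable_fun setT (f k)) (f0 : forall k x, 0 <= f k x).
Hypothesis Qf : forall k (g : T -> \bar R), measurable_fun setT g ->
  (forall x, 0 <= g x)%E -> (\int[Q k]_x g x = \int[P]_x (g x * (f k x)%:E))%E.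
Hypothesis fG : forall k l, (\int[P]_x (f k x * f l x)%:E = (G k l)%:E)%E.
Hypotheses (w0 : forall k, 0 <= w k) (w1 : \sum_k w k = 1).
Hypotheses (delta0 : 0 < delta)
  (chi2 : \sum_k \sum_l w k * w l * G k l <= 1 + delta ^+ 2).

Let L x := \sum_k w k * f k x.

Let L0 x : 0 <= L x.
Proof. by apply: sumr_ge0 => k _; rewrite mulr_ge0. Qed.

Let mL : measurable_fun setT L.
Proof. by apply: measurable_sum => k; exact: measurable_funM. Qed.

Let int_weighted (J : finType) (v : J -> R) (h : J -> T -> R) :
  (forall k, 0 <= v k) -> (forall k x, 0 <= h k x) ->
  (forall k, measurable_fun setT (h k)) ->
  (\int[P]_x (\sum_k v k * h k x)%:E = \sum_k (v k)%:E * \int[P]_x (h k x)%:E)%E.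
Proof.
move=> v0 h0 mh; under eq_integral do rewrite -sumEFin.
rewrite ge0_integral_sum//.
- apply: eq_bigr => k _; under eq_integral do rewrite EFinM.
  rewrite ge0_integralZl//.
  + exact/measurable_EFinP.
  + by move=> x _; rewrite lee_fin.
  + by rewrite lee_fin.
- by move=> k; apply/measurable_EFinP; exact: measurable_funM.
- by move=> k x _; rewrite lee_fin mulr_ge0.
Qed.

Let intf k : (\int[P]_x (f k x)%:E = 1)%E.
Proof.
transitivity (\int[P]_x (cst 1%E x * (f k x)%:E))%E.
  by apply: eq_integral => x _; rewrite mul1e.
by rewrite -Qf//; exact: integral_probability_cst.
Qed.

Let intL : (\int[P]_x (L x)%:E = 1)%E.
Proof.
rewrite int_weighted//; under eq_bigr do rewrite intf mule1.
by rewrite sumEFin w1.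
Qed.

Let intL2 : (\int[P]_x (L x ^+ 2)%:E <= (1 + delta ^+ 2)%:E)%E.
Proof.
rewrite (_ : (\int[P]_x _ =
    \int[P]_x (\sum_(kl : I * I) (w kl.1 * w kl.2) * (f kl.1 x * f kl.2 x))%:E)%E).
  rewrite (int_weighted (v := fun kl => w kl.1 * w kl.2)
    (h := fun kl x => f kl.1 x * f kl.2 x)).
  - under eq_bigr do rewrite fG -EFinM.
    by rewrite sumEFin lee_fin -(pair_bigA _ (fun k l => w k * w l * G k l)).
  - by move=> kl; rewrite mulr_ge0.
  - by move=> kl x; rewrite mulr_ge0.
  - by move=> kl; exact: measurable_funM.
apply: eq_integral => x _; congr (_%:E).
rewrite -(pair_bigA _ (fun k l => w k * w l * (f k x * f l x)))/=.
rewrite expr2 mulr_suml; apply: eq_bigr => k _.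
rewrite mulr_sumr; apply: eq_bigr => l _; ring.
Qed.

(** The sum of errors is the P-integral of 1 on A and of the mixture likelihood ratio L off A, hence
    at least that of min(1, L). [G] is the Gram matrix of the likelihood ratios, so [chi2] bounds
    the integral of L^2. *)
Lemma mixture_testing_bound (A : set T) : measurable A ->
  ((1 - delta)%:E <= P A + \sum_k (w k)%:E * Q k (~` A))%E.
Proof.
move=> mA.
have mAc : measurable (~` A) by exact: measurableC.
have -> : (\sum_k (w k)%:E * Q k (~` A) =
    \int[P]_x (L x * \1_(~` A) x)%:E)%E.
  transitivity (\int[P]_x (\sum_k w k * (\1_(~` A) x * f k x))%:E)%E.
    rewrite (int_weighted (h := fun k x => \1_(~` A) x * f k x))//.
    - apply: eq_bigr => k _; congr (_ * _)%E.
      under eq_integral do rewrite EFinM.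
      rewrite -Qf//.
      + by rewrite integral_indic// setIT.
      + exact/measurable_EFinP.
    - by move=> k x; rewrite mulr_ge0.
    - by move=> k; exact: measurable_funM.
  apply: eq_integral => x _; congr (_%:E); rewrite /L mulr_suml.
  by apply: eq_bigr => k _; ring.
have mLA : measurable_fun setT (fun x => L x * \1_(~` A) x).
  exact: measurable_funM.
have LA0 x : 0 <= L x * \1_(~` A) x by rewrite mulr_ge0.
have -> : P A = (\int[P]_x (\1_A x)%:E)%E by rewrite integral_indic// setIT.
set a := (\int[P]_x (\1_A x)%:E)%E; set b := (\int[P]_x _%:E)%E.
have a0 : (0 <= a)%E by apply: integral_ge0 => x _; rewrite lee_fin.
have b0 : (0 <= b)%E by apply: integral_ge0 => x _; rewrite lee_fin.
pose c := (2 * delta)^-1 + delta / 2.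
have c0 : 0 <= c by rewrite addr_ge0 ?invr_ge0 ?divr_ge0 ?mulr_ge0 ?(ltW delta0).
have di0 : 0 <= delta^-1 by rewrite invr_ge0 ltW.
have d2i0 : 0 <= (2 * delta)^-1 by rewrite invr_ge0 mulr_ge0 ?ltW.
(* Integrates |L - 1| <= delta / 2 + (L - 1)^2 / (2 delta), rearranged so that
   every term is nonnegative. *)
have main : (\int[P]_x (1 + delta^-1 * L x)%:E <=
    \int[P]_x ((\1_A x + L x * \1_(~` A) x) + ((2 * delta)^-1 * L x ^+ 2 + c))%:E)%E.
  apply: ge0_le_integral => //.
  - by move=> x _; rewrite lee_fin addr_ge0// mulr_ge0.
  - apply/measurable_EFinP; apply: measurable_funD => //; exact: measurable_funM.
  - apply/measurable_EFinP; apply: measurable_funD; apply: measurable_funD => //.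
    by apply: measurable_funM => //; exact: measurable_funX.
  - move=> x _; rewrite lee_fin.
    have H : 1 + delta^-1 * L x <=
        Num.min 1 (L x) + ((2 * delta)^-1 * L x ^+ 2 + c).
      rewrite -subr_ge0 /c.
      have [Lx|Lx] := leP 1 (L x).
      + have -> : 1 + ((2 * delta)^-1 * L x ^+ 2 + ((2 * delta)^-1 + delta / 2)) -
           (1 + delta^-1 * L x) = (2 * delta)^-1 * (L x - 1) ^+ 2 + delta / 2.
          by field; rewrite gt_eqF.
        by rewrite addr_ge0 ?divr_ge0 ?(ltW delta0)// mulr_ge0 ?sqr_ge0.
      + have -> : L x + ((2 * delta)^-1 * L x ^+ 2 + ((2 * delta)^-1 + delta / 2)) -
           (1 + delta^-1 * L x) = (2 * delta)^-1 * (L x - 1 + delta) ^+ 2.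
          by field; rewrite gt_eqF.
        by rewrite mulr_ge0 ?sqr_ge0.
    apply: le_trans H _; rewrite lerD2r !indicE.
    have [xA|xA] := boolP (x \in A).
    + by rewrite (_ : x \in ~` A = false) ?mulr0 ?addr0 ?ge_min ?lexx// in_setC xA.
    + by rewrite (_ : x \in ~` A) ?mulr1 ?add0r ?ge_min ?lexx ?orbT// in_setC.
have lhs : (\int[P]_x (1 + delta^-1 * L x)%:E = (1 + delta^-1)%:E)%E.
  under eq_integral do rewrite EFinD EFinM.
  rewrite ge0_integralD//; last 2 first.
  - by move=> x _; rewrite -EFinM lee_fin mulr_ge0.
  - by apply: emeasurable_funM => //; exact/measurable_EFinP.
  rewrite integral_probability_cst ge0_integralZl ?intL ?mule1//.
  - exact/measurable_EFinP.
  - by move=> x _; rewrite lee_fin.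
have mL2 : measurable_fun setT (fun x => (L x ^+ 2)%:E).
  by apply/measurable_EFinP; exact: measurable_funX.
have rhs : (\int[P]_x ((\1_A x + L x * \1_(~` A) x) +
     ((2 * delta)^-1 * L x ^+ 2 + c))%:E =
   a + b + ((2 * delta)^-1%:E * \int[P]_x (L x ^+ 2)%:E + c%:E))%E.
  under eq_integral do rewrite EFinD [X in (X + _)%E]EFinD [X in (_ + X)%E]EFinD
    [X in (_ + (X + _))%E]EFinM.
  rewrite ge0_integralD//; last 4 first.
  - by move=> x _; rewrite -EFinD lee_fin addr_ge0.
  - by apply: emeasurable_funD; exact/measurable_EFinP.
  - by move=> x _; rewrite -EFinM -EFinD lee_fin addr_ge0// mulr_ge0 ?sqr_ge0.
  - by apply: emeasurable_funD => //; exact: emeasurable_funM.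
  congr (_ + _)%E.
    by rewrite ge0_integralD//; first [exact/measurable_EFinP|move=> x _; rewrite lee_fin].
  rewrite ge0_integralD//; last 2 first.
  - by move=> x _; rewrite -EFinM lee_fin mulr_ge0 ?sqr_ge0.
  - exact: emeasurable_funM.
  rewrite integral_probability_cst ge0_integralZl//.
  by move=> x _; rewrite lee_fin sqr_ge0.
rewrite lhs rhs in main.
have main2 : ((1 + delta^-1)%:E <=
    a + b + ((2 * delta)^-1 * (1 + delta ^+ 2) + c)%:E)%E.
  apply: le_trans main _; apply: leeD => //.
  rewrite [leRHS]EFinD; apply: leeD => //; rewrite [leRHS]EFinM.
  by apply: lee_wpmul2l.
rewrite -leeBlDr// -EFinB in main2.
apply: le_trans main2; rewrite lee_fin /c le_eqVlt; apply/orP; left; apply/eqP.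
by field; rewrite gt_eqF.
Qed.

End mixture_testing.

(** * Priors on Gaussian means *)

Section gaussian_likelihood_ratio.
Context (R : realType) (d : nat) (sigma : 'I_d -> R).
Hypothesis sigma0 : forall j, 0 < sigma j.
Notation rV := (d.-tuple (measurableTypeR R)).
Implicit Types (theta : d.-tuple R).

Let sn0 j : sigma j != 0. Proof. by rewrite gt_eqF. Qed.

Definition gauss_lr theta (x : rV) : R :=
  \prod_(j < d) normal_lr (tnth theta j) (sigma j) (tnth x j).

Lemma gauss_lr_ge0 theta x : 0 <= gauss_lr theta x.
Proof. by apply: prodr_ge0 => j _; exact: expR_ge0. Qed.

Lemma measurable_gauss_lr theta : measurable_fun setT (gauss_lr theta).
Proof.
apply: measurable_prod => j _.
apply: (measurableT_comp (measurable_normal_lr _ _)); exact: measurable_tnth.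
Qed.

Lemma ge0_integral_gauss_lr theta (g : rV -> \bar R) :
  measurable_fun setT g -> (forall x, (0 <= g x)%E) ->
  (\int[gauss sigma theta]_x g x =
   \int[gauss sigma (nseq_tuple d 0%R)]_x (g x * (gauss_lr theta x)%:E))%E.
Proof.
move=> mg g0.
apply: (@ge0_integral_product_prob_density _ (measurableTypeR R) R d
  (fun j => normal_prob (tnth theta j) (sigma j))
  (fun j => normal_prob (tnth (nseq_tuple d 0%R) j) (sigma j))
  (fun j => normal_lr (tnth theta j) (sigma j))).
- by move=> j; exact: measurable_normal_lr.
- by move=> j x; exact: expR_ge0.
- move=> j h mh h0; rewrite tnth_nseq.
  exact: (ge0_integral_normal_lr (tnth theta j) (sn0 j) mh h0).
- exact: mg.
- exact: g0.
Qed.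

(** The product is a constant times the likelihood ratio at theta1 + theta2, which integrates to
    1. *)
Lemma integral_gauss_lrM theta1 theta2 :
  (\int[gauss sigma (nseq_tuple d 0%R)]_x
     (gauss_lr theta1 x * gauss_lr theta2 x)%:E =
   (expR (\sum_(j < d) tnth theta1 j * tnth theta2 j / sigma j ^+ 2))%:E)%E.
Proof.
pose th := [tuple tnth theta1 j + tnth theta2 j | j < d].
set e := expR _.
have E x : gauss_lr theta1 x * gauss_lr theta2 x = e * gauss_lr th x.
  rewrite /e expR_sum /gauss_lr -!big_split/=; apply: eq_bigr => j _.
  rewrite tnth_mktuple /normal_lr -!expRD; congr expR.
  by field; rewrite gt_eqF.
transitivity (\int[gauss sigma (nseq_tuple d 0%R)]_x
   (e%:E * (gauss_lr th x)%:E))%E.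
  by apply: eq_integral => x _; rewrite E EFinM.
have mlr : measurable_fun setT (fun x => (gauss_lr th x)%:E).
  by apply/measurable_EFinP; exact: measurable_gauss_lr.
rewrite ge0_integralZl//; last 2 first.
- by move=> x _; rewrite lee_fin gauss_lr_ge0.
- by rewrite lee_fin expR_ge0.
rewrite -[RHS]mule1; congr (_ * _)%E.
transitivity (\int[gauss sigma (nseq_tuple d 0%R)]_x
    (cst 1%E x * (gauss_lr th x)%:E))%E.
  by apply: eq_integral => x _; rewrite mul1e.
by rewrite -ge0_integral_gauss_lr//; exact: integral_probability_cst.
Qed.

(** One delta pays for the chi-square divergence and one for the prior mass on indices that are not
    [good], where the error probability is only bounded by 1. *)
Lemma minimax_risk_prior_lower (I : finType) (w : I -> R)
    (th : I -> d.-tuple R) (good : pred I) (delta eps t : R) (s : nat) :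
  0 < delta < 1 -> (forall k, 0 <= w k) -> \sum_k w k = 1 ->
  \sum_k \sum_l w k * w l *
     expR (\sum_(j < d) tnth (th k) j * tnth (th l) j / sigma j ^+ 2)
    <= 1 + delta ^+ 2 ->
  \sum_(k | ~~ good k) w k <= delta ->
  (forall k, good k -> Theta eps s t (th k)) ->
  ((1 - 2 * delta)%:E <= minimax_risk eps s t sigma)%E.
Proof.
move=> /andP[delta0 delta1] w0 w1 chi2 bad goodP.
apply: le_ereal_inf_tmp => _ [psi /= mpsi <-]; rewrite /risk.
have mset b : measurable [set x | psi x = b].
  by rewrite -[X in measurable X]setTI; exact: (mpsi measurableT [set b]).
have := @mixture_testing_bound _ _ _ I (gauss sigma (nseq_tuple d 0%R))
  (fun k => gauss sigma (th k)) (fun k => gauss_lr (th k)) w _ delta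
  (fun k => measurable_gauss_lr (th k)) (fun k x => gauss_lr_ge0 (th k) x)
  (fun k g mg g0 => ge0_integral_gauss_lr (th k) mg g0)
  (fun k l => integral_gauss_lrM (th k) (th l)) w0 w1 delta0 chi2
  [set x | psi x = true] (mset true).
have -> : ~` [set x | psi x = true] = [set x | psi x = false].
  by apply/seteqP; split => x /=; case: (psi x).
set S := ereal_sup _.
move=> H.
have le1 k : (gauss sigma (th k) [set x | psi x = false] <= 1)%E.
  by apply: probability_le1; exact: mset.
have leS k : good k -> (gauss sigma (th k) [set x | psi x = false] <= S)%E.
  by move=> gk; apply: ereal_sup_ubound; exists (th k) => //; exact: goodP.
(* The supremum of an empty set would be -oo. Since the bad mass is below 1, some index is good and
   the alternative is nonempty. *)
have S0 : (0 <= S)%E.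
  have [k gk] : exists k, good k.
    apply/existsP; apply: contraT => /existsPn nogood.
    by move: bad; rewrite (eq_bigl xpredT) ?w1 ?leNgt ?delta1.
  by apply: le_trans (leS k gk); exact: measure_ge0.
have sumle : (\sum_k (w k)%:E * gauss sigma (th k) [set x | psi x = false]
    <= S + delta%:E)%E.
  rewrite (bigID good)/=; apply: leeD.
    apply: (@le_trans _ _ (\sum_(k | good k) (w k)%:E * S)%E).
      by apply: lee_sum => k gk; apply: lee_wpmul2l; [rewrite lee_fin|exact: leS].
    rewrite -ge0_sume_distrl; last by move=> k _; rewrite lee_fin.
    rewrite sumEFin -[leRHS]mul1e; apply: lee_wpmul2r => //.
    rewrite lee_fin -w1 [leLHS]big_mkcond/=; apply: ler_sum => k _.
    by case: ifP.
  apply: (@le_trans _ _ (\sum_(k | ~~ good k) (w k)%:E)%E).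
    apply: lee_sum => k _; rewrite -[leRHS]mule1.
    by apply: lee_wpmul2l; [rewrite lee_fin|exact: le1].
  by rewrite sumEFin lee_fin.
have H2 : ((1 - delta)%:E <=
    gauss sigma (nseq_tuple d 0%R) [set x | psi x = true] + S + delta%:E)%E.
  by apply: le_trans H _; rewrite -addeA; apply: leeD.
rewrite -leeBlDr// -EFinB in H2.
by apply: le_trans H2; rewrite lee_fin; lra.
Qed.

End gaussian_likelihood_ratio.

Section cosh.
Context (R : realType).
Implicit Types (k x : R).

(** cosh x - 1: what two independent random signs leave of the chi-square divergence on a shared
    coordinate. *)
Definition coshm1 x : R := (expR x + expR (- x)) / 2 - 1.

Lemma coshm1_ge0 x : 0 <= coshm1 x.
Proof. by have := expR_ge1Dx x; have := expR_ge1Dx (- x); rewrite /coshm1; lra. Qed.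

(** Convexity of exp between 0 and x, read off its tangent at k x evaluated at both ends. *)
Lemma expR_mul_le k x : 0 <= k <= 1 -> expR (k * x) <= k * expR x + (1 - k).
Proof.
move=> /andP[k0 k1]; set E := expR (k * x).
have E0 : 0 < E by exact: expR_gt0.
have e1 : E * (1 + (1 - k) * x) <= expR x.
  rewrite (_ : expR x = E * expR ((1 - k) * x)); last first.
    by rewrite -expRD; congr expR; ring.
  by rewrite ler_pM2l// expR_ge1Dx.
have e2 : E * (1 - k * x) <= 1.
  rewrite -[leRHS](expRxMexpNx_1 (k * x)) ler_pM2l//.
  exact: expR_ge1Dx.
have := ler_wpM2l k0 e1.
have : (1 - k) * (E * (1 - k * x)) <= (1 - k) * 1 by rewrite ler_wpM2l// subr_ge0.
by nra.
Qed.

(** Shrinking the squared amplitude by [k] gains a factor [k] over exp x, which for x = lam^2 /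
    sigma_j^2 is the weight appearing in [pr_sqr]. *)
Lemma coshm1_mul_le k x : 0 <= k <= 1 -> 0 <= x -> coshm1 (k * x) <= k * expR x.
Proof.
move=> k01 x0; have := expR_mul_le x k01; have := expR_mul_le (- x) k01.
rewrite mulrN; have : expR (- x) <= expR x by rewrite ler_expR; lra.
move: k01 => /andP[k0 _] h1 h2 h3; rewrite /coshm1.
by have := ler_wpM2l k0 h1; have := ler_wpM2l k0 (expR_ge0 x); nra.
Qed.

End cosh.

Section finite_products.
Context (R : realType) (d : nat) (V : finType).

Lemma sum_ffun_prod2 (F : 'I_d -> V -> V -> R) :
  \sum_(o : {ffun 'I_d -> V}) \sum_(o' : {ffun 'I_d -> V})
     \prod_j F j (o j) (o' j) =
  \prod_j \sum_v \sum_v' F j v v'.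
Proof.
rewrite bigA_distr_bigA; apply: eq_bigr => o _.
by rewrite bigA_distr_bigA.
Qed.

Lemma sum_ffun_sqr (wt h : 'I_d -> V -> R) :
  (forall j, \sum_v wt j v = 1) -> (forall j, \sum_v wt j v * h j v = 0) ->
  \sum_(o : {ffun 'I_d -> V}) (\prod_j wt j (o j)) * (\sum_j h j (o j)) ^+ 2
  = \sum_j \sum_v wt j v * h j v ^+ 2.
Proof.
move=> wt1 h0.
have cross i k : \sum_(o : {ffun 'I_d -> V})
    (\prod_j wt j (o j)) * (h i (o i) * h k (o k)) =
    if i == k then \sum_v wt i v * h i v ^+ 2 else 0.
  (* Writes the single factor h_l as a product over all coordinates, so that the sum over functions
     factorises. *)
  pose g l j v := if j == l then h j v else 1.
  transitivity (\prod_j \sum_v wt j v * (g i j v * g k j v)).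
    rewrite bigA_distr_bigA; apply: eq_bigr => o _; rewrite !big_split/=.
    congr (_ * (_ * _)); rewrite /g -big_mkcond/= big_pred1_eq//.
  case: eqP => [<-|/eqP ik].
    rewrite (bigD1 i)//= [X in _ * X]big1 ?mulr1; last first.
      move=> j ji; rewrite -[RHS](wt1 j); apply: eq_bigr => v _.
      by rewrite /g (negbTE ji) !mulr1.
    by apply: eq_bigr => v _; rewrite /g eqxx expr2.
  rewrite (bigD1 i)//= [X in X * _](_ : _ = 0) ?mul0r// -[RHS](h0 i).
  by apply: eq_bigr => v _; rewrite /g eqxx (negbTE ik) mulr1.
transitivity (\sum_i \sum_k \sum_(o : {ffun 'I_d -> V})
    (\prod_j wt j (o j)) * (h i (o i) * h k (o k))).
  transitivity (\sum_(o : {ffun 'I_d -> V}) \sum_i \sum_k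
      (\prod_j wt j (o j)) * (h i (o i) * h k (o k))).
    apply: eq_bigr => o _; rewrite expr2 mulr_suml mulr_sumr.
    by apply: eq_bigr => i _; rewrite !mulr_sumr.
  rewrite exchange_big/=; apply: eq_bigr => i _.
  by rewrite exchange_big/=.
apply: eq_bigr => i _; under eq_bigr do rewrite cross.
by rewrite -big_mkcond/= (big_pred1 i)// => k; rewrite /= eq_sym.
Qed.

End finite_products.

Section sparse_priors.
Context (R : realType) (d : nat) (sigma : 'I_d -> R) (t : R).
Hypotheses (sigma0 : forall j, 0 < sigma j) (t0 : 0 < t).

Lemma norm_t_ge (theta : d.-tuple R) (eps : R) : 0 <= eps ->
  eps `^ t <= \sum_j `|tnth theta j| `^ t -> eps <= norm_t t theta.
Proof.
move=> e0 H; have ti0 : 0 <= t^-1 by rewrite invr_ge0 ltW.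
have := ler_powR2r ti0 (powR_ge0 _ _) H.
by rewrite -powRrM mulfV ?gt_eqF// powRr1.
Qed.

(** Prior: an index drawn from [p], carrying [a] with a uniform sign. Two independent draws interact
    only when they pick the same index, and the average over signs is then a cosh. *)
Lemma single_index_prior_lower (p : 'I_d -> R) (a delta eps : R) (s : nat) :
  0 < delta < 1 -> (0 < s)%N -> (forall j, 0 <= p j) -> \sum_j p j = 1 ->
  0 <= a -> \sum_j p j ^+ 2 * coshm1 (a ^+ 2 / sigma j ^+ 2) <= delta ^+ 2 ->
  0 <= eps -> eps `^ t <= a `^ t ->
  ((1 - 2 * delta)%:E <= minimax_risk eps s t sigma)%E.
Proof.
move=> hdelta s0 p0 p1 a0 chi e0 ea.
pose sg (b : bool) : R := if b then 1 else -1.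
pose th (k : 'I_d * bool) : d.-tuple R :=
  [tuple if i == k.1 then sg k.2 * a else 0 | i < d].
have tht k j : tnth (th k) j = if j == k.1 then sg k.2 * a else 0.
  by rewrite tnth_mktuple.
have inner k l : \sum_j tnth (th k) j * tnth (th l) j / sigma j ^+ 2 =
    if k.1 == l.1 then sg k.2 * sg l.2 * (a ^+ 2 / sigma k.1 ^+ 2) else 0.
  rewrite (bigD1 k.1)//= big1 ?addr0; last first.
    by move=> j /negbTE jk; rewrite !tht jk !mul0r.
  rewrite !tht eqxx; case: eqP => _; last by rewrite mulr0 mul0r.
  by ring.
apply: (@minimax_risk_prior_lower _ _ _ sigma0 ('I_d * bool)%type
  (fun k => p k.1 / 2) th xpredT delta) => //.
- by move=> k; rewrite divr_ge0.
- rewrite -(pair_bigA _ (fun j (b : bool) => p j / 2))/= -[RHS]p1.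
  by apply: eq_bigr => j _; rewrite big_bool/= -splitr.
- have -> : \sum_k \sum_l p k.1 / 2 * (p l.1 / 2) *
      expR (\sum_j tnth (th k) j * tnth (th l) j / sigma j ^+ 2) =
    \sum_j \sum_l (p j * p l +
       if j == l then p j ^+ 2 * coshm1 (a ^+ 2 / sigma j ^+ 2) else 0).
    under eq_bigr do under eq_bigr do rewrite inner.
    rewrite -(pair_bigA _ (fun j b => \sum_(l : 'I_d * bool) p j / 2 * (p l.1 / 2) *
      expR (if j == l.1 then sg b * sg l.2 * (a ^+ 2 / sigma j ^+ 2) else 0)))/=.
    apply: eq_bigr => j _; rewrite big_bool/=.
    rewrite -(pair_bigA _ (fun l c => p j / 2 * (p l / 2) *
      expR (if j == l then sg true * sg c * (a ^+ 2 / sigma j ^+ 2) else 0)))/=.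
    rewrite -(pair_bigA _ (fun l c => p j / 2 * (p l / 2) *
      expR (if j == l then sg false * sg c * (a ^+ 2 / sigma j ^+ 2) else 0)))/=.
    rewrite -big_split/=; apply: eq_bigr => l _; rewrite !big_bool/=.
    case: eqP => [<-|_]; last by rewrite expR0; field.
    by rewrite /sg /coshm1 !(mul1r, mulr1, mulN1r, opprK); field.
  under eq_bigr do rewrite big_split/= -mulr_sumr p1 mulr1.
  rewrite big_split/= p1 lerD2l.
  apply: le_trans chi; rewrite le_eqVlt; apply/orP; left; apply/eqP.
  by apply: eq_bigr => j _; rewrite -big_mkcond/= (big_pred1 j)// => k; rewrite /= eq_sym.
- by rewrite big_pred0 ?ltW//; case/andP: hdelta.
- move=> k _; split.
    apply: norm_t_ge => //; apply: (le_trans ea).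
    rewrite (bigD1 k.1)//= tht eqxx normrM [`|sg _|](_ : _ = 1) ?mul1r.
      by rewrite (ger0_norm a0) lerDl sumr_ge0// => j _; exact: powR_ge0.
    by rewrite /sg; case: k.2; rewrite ?normrN normr1.
  rewrite /norm_0 (leq_trans _ s0)// -(card1 k.1); apply: subset_leq_card.
  apply/fintype.subsetP => j; rewrite !inE tht.
  by case: (j == k.1); rewrite ?eqxx.
Qed.

(** Each coordinate contributes a chi-square factor 1 + pr_j^2 (cosh - 1), bounded by an
    exponential. Two Chebyshev bounds cost delta / 2 each: the support has mean and variance at most
    s / 2 and must not exceed s, whence 4 <= delta s; the t-th power of the norm must reach half its
    mean [mu], whence the factor 8. *)
Lemma product_prior_lower (pr a : 'I_d -> R) (delta kappa eps : R) (s : nat) :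
  0 < delta < 1 -> (forall j, 0 <= pr j <= 1) -> (forall j, 0 <= a j) ->
  \sum_j pr j ^+ 2 * coshm1 (a j ^+ 2 / sigma j ^+ 2) <= kappa ->
  expR kappa <= 1 + delta ^+ 2 ->
  \sum_j pr j <= s%:R / 2 -> 4 <= delta * s%:R ->
  let mu := \sum_j pr j * a j `^ t in
  0 < mu -> 8 * (\sum_j pr j * a j `^ (2 * t)) <= delta * mu ^+ 2 ->
  0 <= eps -> eps `^ t <= mu / 2 ->
  ((1 - 2 * delta)%:E <= minimax_risk eps s t sigma)%E.
Proof.
move=> hdelta hpr a0 chi hkappa hsum hs mu mu0 hvar e0 emu.
have /andP[delta0 delta1] := hdelta.
have pr0 j : 0 <= pr j by case/andP: (hpr j).
have pr1 j : pr j <= 1 by case/andP: (hpr j).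
(* A coordinate (b, c) is switched on iff b, with sign c; c is still drawn when
   the coordinate is off, which keeps the prior a product. *)
pose V := (bool * bool)%type.
pose act (v : V) : R := v.1%:R.
pose vl (j : 'I_d) (v : V) : R := if v.1 then (if v.2 then a j else - a j) else 0.
pose wt (j : 'I_d) (v : V) : R := (if v.1 then pr j else 1 - pr j) / 2.
have sumV (g : V -> R) : \sum_v g v =
    g (true, true) + g (true, false) + (g (false, true) + g (false, false)).
  have -> : \sum_v g v = \sum_b \sum_c g (b, c).
    by rewrite pair_bigA/=; apply: eq_bigr => -[].
  by rewrite !big_bool.
have wt0 j v : 0 <= wt j v.
  by rewrite /wt divr_ge0//; case: ifP => _ //; rewrite subr_ge0.
have wt1 j : \sum_v wt j v = 1 by rewrite sumV /wt/=; field.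
pose W (o : {ffun 'I_d -> V}) := \prod_j wt j (o j).
have W0 o : 0 <= W o by exact: prodr_ge0.
pose th (o : {ffun 'I_d -> V}) : d.-tuple R := [tuple vl j (o j) | j < d].
have tht o j : tnth (th o) j = vl j (o j) by rewrite tnth_mktuple.
pose Y (b : 'I_d -> R) (o : {ffun 'I_d -> V}) := \sum_j (act (o j) - pr j) * b j.
have varY b : \sum_o W o * Y b o ^+ 2 <= \sum_j pr j * b j ^+ 2.
  rewrite (sum_ffun_sqr (h := fun j v => (act v - pr j) * b j))//; last first.
    by move=> j; rewrite sumV /wt /act/=; field.
  apply: ler_sum => j _; rewrite sumV /wt /act/=.
  have := pr0 j; have := pr1 j; have := sqr_ge0 (b j).
  set x := pr j; set y := b j => y2 x1 x0.
  have : 0 <= x ^+ 2 * y ^+ 2 by rewrite mulr_ge0 ?sqr_ge0.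
  by lra.
have cheb b c (B : pred {ffun 'I_d -> V}) : 0 < c ->
    (forall o, B o -> c <= `|Y b o|) ->
    \sum_(o | B o) W o <= (\sum_j pr j * b j ^+ 2) / c ^+ 2.
  move=> c0 hB; rewrite ler_pdivlMr ?exprn_gt0//.
  apply: le_trans (varY b); rewrite mulr_suml big_mkcond/=.
  apply: ler_sum => o _; case: ifP => Bo; last by rewrite mulr_ge0 ?sqr_ge0.
  rewrite ler_wpM2l// -[leRHS](real_normK (num_real _)).
  by rewrite ler_pXn2r ?nnegrE ?(ltW c0)//; exact: hB.
pose cnt (o : {ffun 'I_d -> V}) := (\sum_j act (o j) <= s%:R).
pose big (o : {ffun 'I_d -> V}) := (mu / 2 <= \sum_j act (o j) * a j `^ t).
have sR : 0 < s%:R :> R.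
  rewrite ltr0n lt0n; apply: contraTneq hs => ->.
  by rewrite mulr0 -ltNge.
have bad1 : \sum_(o | ~~ cnt o) W o <= delta / 2.
  apply: le_trans (cheb (fun=> 1) (s%:R / 2) _ _ _) _.
  - by rewrite divr_gt0.
  - move=> o; rewrite /cnt -ltNge => ho.
    have -> : Y (fun=> 1) o = \sum_j act (o j) - \sum_j pr j.
      by rewrite /Y -sumrB; apply: eq_bigr => j _; rewrite mulr1.
    by apply: le_trans (ler_norm _); lra.
  - rewrite ler_pdivrMr ?exprn_gt0 ?divr_gt0//.
    under eq_bigr do rewrite expr1n mulr1.
    apply: (le_trans hsum).
    have := ler_wpM2r (ltW sR) hs; rewrite expr2.
    by lra.
have bad2 : \sum_(o | ~~ big o) W o <= delta / 2.
  apply: le_trans (cheb (fun j => a j `^ t) (mu / 2) _ _ _) _.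
  - by rewrite divr_gt0.
  - move=> o; rewrite /big -ltNge => ho.
    have -> : Y (fun j => a j `^ t) o = \sum_j act (o j) * a j `^ t - mu.
      by rewrite /Y /mu -sumrB; apply: eq_bigr => j _; rewrite mulrBl.
    by rewrite ler_normr; apply/orP; right; lra.
  - rewrite ler_pdivrMr ?exprn_gt0 ?divr_gt0//.
    under eq_bigr do rewrite powR_sqr.
    by move: hvar; rewrite exprMn; lra.
apply: (@minimax_risk_prior_lower _ _ _ sigma0 {ffun 'I_d -> V}
  W th (fun o => cnt o && big o) delta) => //.
- rewrite /W -(bigA_distr_bigA (fun j v => wt j v)); apply: big1 => j _.
  exact: wt1.
- apply: le_trans hkappa.
  rewrite (_ : \sum_k _ = \prod_j \sum_v \sum_v'
     wt j v * wt j v' * expR (vl j v * vl j v' / sigma j ^+ 2)); last first.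
    rewrite -(sum_ffun_prod2 (fun j v v' =>
      wt j v * wt j v' * expR (vl j v * vl j v' / sigma j ^+ 2))).
    apply: eq_bigr => o _; apply: eq_bigr => o' _.
    rewrite /W -big_split/= expR_sum -big_split/=.
    by apply: eq_bigr => j _; rewrite !tht.
  apply: (@le_trans _ _ (\prod_j expR (pr j ^+ 2 * coshm1 (a j ^+ 2 / sigma j ^+ 2)))).
    apply: ler_prod => j _; apply/andP; split.
      by apply: sumr_ge0 => v _; apply: sumr_ge0 => v' _;
        rewrite mulr_ge0 ?expR_ge0// mulr_ge0.
    rewrite sumV !sumV /wt /vl/= !(mulr0, mul0r) expR0.
    rewrite mulrNN mulrN !mulNr -expr2.
    apply: le_trans (expR_ge1Dx _); rewrite /coshm1.
    set e1 := expR _; set e2 := expR _.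
    by rewrite le_eqVlt; apply/orP; left; apply/eqP; field.
  by rewrite -expR_sum ler_expR.
- have -> : delta = delta / 2 + delta / 2 by rewrite -splitr.
  apply: le_trans (lerD bad1 bad2).
  rewrite [leLHS]big_mkcond [X in _ <= X + _]big_mkcond [X in _ <= _ + X]big_mkcond.
  rewrite -big_split/=; apply: ler_sum => o _.
  by rewrite negb_and; case: (cnt o); case: (big o); rewrite /= ?addr0 ?add0r ?lerDl.
- move=> o /andP[co bo]; split.
    apply: norm_t_ge => //; apply: (le_trans emu); apply: (le_trans bo).
    apply: ler_sum => j _; rewrite tht /act /vl.
    case: (o j) => -[] c /=; last by rewrite mul0r powR_ge0.
    by rewrite mul1r; case: c; rewrite ?normrN ger0_norm.
  rewrite -(ler_nat R); apply: le_trans co.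
  rewrite /norm_0 -sum1_card natr_sum big_mkcond/=; apply: ler_sum => j _.
  rewrite inE tht /act /vl; case: (o j) => -[] c /=; last by rewrite eqxx.
  by case: ifP.
Qed.

End sparse_priors.

(** * The equation for beta *)

Section beta_equation_solution.
Context (R : realType) (d : nat) (sigma : 'I_d -> R) (s : nat) (t : R).
Hypotheses (d0 : (0 < d)%N) (sigma0 : forall j, 0 < sigma j).
Hypothesis sigma_noninc : forall i j : 'I_d, (i <= j)%N -> sigma j <= sigma i.
Hypotheses (t0 : 0 < t) (sd : (1 <= s <= d)%N).

(** The numerator of the equation for beta at p = t, and the radicand of its denominator at p = 2
    t. *)
Definition wsum (p b : R) : R := \sum_(j < d) sigma j `^ p * expR (- b / sigma j ^+ 2).

Let top : 'I_d := Ordinal d0.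

Let le_top j : sigma j <= sigma top.
Proof. exact: sigma_noninc. Qed.

Lemma wsum_gt0 p b : 0 < wsum p b.
Proof.
rewrite /wsum (bigD1 top)//= ltr_pwDl//.
  by rewrite mulr_gt0 ?expR_gt0// powR_gt0.
by apply: sumr_ge0 => j _; rewrite mulr_ge0 ?expR_ge0// powR_ge0.
Qed.

Let continuous_wsum p : continuous (wsum p).
Proof.
move=> b; rewrite /wsum; apply: (@cvg_big _ _ +%R) => //.
- by move=> [x y]; apply: cvgD; [exact: cvg_fst|exact: cvg_snd].
- move=> j _; apply: cvgMr; apply: continuous_comp; last exact: continuous_expR.
  by apply: cvgMl; exact: opp_continuous.
Qed.

Let sqr_term p b j : sigma j `^ (2 * p) * expR (- b / sigma j ^+ 2) =
  (sigma j `^ p * expR (- b / 2 / sigma j ^+ 2)) ^+ 2.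
Proof.
rewrite exprMn powR_sqr -expRM_natl; congr (_ * expR _).
by field; rewrite gt_eqF.
Qed.

Let half_term p b j : sigma j `^ p * expR (- b / sigma j ^+ 2) =
  sigma j `^ p * expR (- b / 2 / sigma j ^+ 2) * expR (- b / 2 / sigma j ^+ 2).
Proof. by rewrite -mulrA -expRD; congr (_ * expR _); field; rewrite gt_eqF. Qed.

(** Ensures that [xget] in [beta] returns a solution and not its default 0. The intermediate value
    theorem is applied to [g], the equation with its denominator cleared. *)
Lemma beta_equation_solvable : exists b, beta_equation s t sigma b.
Proof.
case/andP: sd => s1 _; have sR : 1 <= s%:R :> R by rewrite ler1n.
have dR : 1 <= d%:R :> R by rewrite ler1n.
pose g b := wsum t b - s%:R / 2 * Num.sqrt (wsum (2 * t) b).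
have cg : continuous g.
  move=> b; apply: cvgB; first exact: continuous_wsum.
  apply: cvgMr; apply: continuous_comp; first exact: continuous_wsum.
  exact: sqrt_continuous.
pose u b j := sigma j `^ t * expR (- b / 2 / sigma j ^+ 2).
have u0 b j : 0 <= u b j by rewrite mulr_ge0 ?expR_ge0// powR_ge0.
have wu b : wsum (2 * t) b = \sum_j u b j ^+ 2.
  by apply: eq_bigr => j _; exact: sqr_term.
have w1 b : wsum t b = \sum_j u b j * expR (- b / 2 / sigma j ^+ 2).
  by apply: eq_bigr => j _; exact: half_term.
(* Here exp(- b1 / (2 sigma_j^2)) >= exp s >= s for every j, so the numerator is at least s times
   the sum of the u_j, which dominates the denominator. *)
pose b1 := - (2 * sigma top ^+ 2 * s%:R).
(* Here the same exponentials are at most exp(- 2 d), and d exp(- 2 d) <= 1/2 <= s / 2. *)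
pose b2 := 2 * sigma top ^+ 2 * (2 * d%:R).
have top2 : 0 < sigma top ^+ 2 by rewrite exprn_gt0.
have top_j j : sigma j ^+ 2 <= sigma top ^+ 2.
  by rewrite ler_pXn2r ?nnegrE ?le_top// ltW.
have b12 : b1 <= b2.
  rewrite (@le_trans _ _ 0)// /b1 /b2.
    by rewrite oppr_le0 !mulr_ge0// ltW.
  by rewrite !mulr_ge0// ltW.
have g1 : 0 <= g b1.
  rewrite subr_ge0; apply: (@le_trans _ _ (s%:R * \sum_j u b1 j)).
    have : Num.sqrt (wsum (2 * t) b1) <= \sum_j u b1 j.
      rewrite wu -[leRHS]ger0_norm ?sumr_ge0// -sqrtr_sqr; apply: ler_wsqrtr.
      exact: sum_sqr_le_sqr_sum.
    have := sqrtr_ge0 (wsum (2 * t) b1); set x := Num.sqrt _ => x0 xle.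
    by have := ler_wpM2l (le_trans ler01 sR) xle; nra.
  rewrite w1 mulr_sumr; apply: ler_sum => j _; rewrite mulrC ler_wpM2l//.
  apply: le_trans (_ : expR s%:R <= _); first by have := expR_ge1Dx (s%:R : R); lra.
  rewrite ler_expR /b1 opprK ler_pdivlMr ?exprn_gt0//.
  rewrite (_ : 2 * sigma top ^+ 2 * s%:R / 2 = s%:R * sigma top ^+ 2); last by field.
  by rewrite ler_wpM2l.
have g2 : g b2 <= 0.
  rewrite subr_le0.
  have usq j : u b2 j <= Num.sqrt (wsum (2 * t) b2).
    rewrite -[leLHS]ger0_norm// -sqrtr_sqr; apply: ler_wsqrtr.
    by rewrite wu (bigD1 j)//= lerDl sumr_ge0// => i _; exact: sqr_ge0.
  have ed : d%:R * expR (- (2 * d%:R)) <= 2^-1 :> R.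
    rewrite expRN ler_pdivrMr ?expR_gt0//.
    by have := expR_ge1Dx (2 * d%:R : R); lra.
  apply: (@le_trans _ _ (expR (- (2 * d%:R)) * (d%:R * Num.sqrt (wsum (2 * t) b2)))).
    rewrite w1; apply: (@le_trans _ _ (\sum_j expR (- (2 * d%:R)) * u b2 j)).
      apply: ler_sum => j _; rewrite mulrC ler_wpM2r// ler_expR /b2.
      rewrite !mulNr lerN2 ler_pdivlMr ?exprn_gt0//.
      rewrite (_ : _ * _ * _ / 2 = (2 * d%:R) * sigma top ^+ 2); last by field.
      by rewrite ler_wpM2l// mulr_ge0.
    rewrite -mulr_sumr ler_wpM2l ?expR_ge0//.
    rewrite mulr_natl -[in leRHS](card_ord d) -sumr_const.
    exact: ler_sum.
  rewrite mulrA ler_wpM2r ?sqrtr_ge0// [leLHS]mulrC.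
  by apply: (le_trans ed); lra.
have [b _ gb] : exists2 b, b \in `[b1, b2] & g b = 0.
  apply: IVT => //.
    exact: continuous_subspaceT.
  by rewrite ge_min le_max g1 g2 orbT.
exists b; rewrite /beta_equation -/(wsum t b) -/(wsum (2 * t) b).
apply/eqP; rewrite -subr_eq0 -[X in _ == X](mul0r (Num.sqrt (wsum (2 * t) b))^-1) -gb.
have sq0 : 0 < Num.sqrt (wsum (2 * t) b) by rewrite sqrtr_gt0 wsum_gt0.
by apply/eqP; rewrite /g; field; rewrite gt_eqF.
Qed.

(* Chebyshev's sum inequality: as sigma_j grows, sigma_j ^ t increases while
   exp(- b / sigma_j ^ 2) decreases when b <= 0. It turns the equation at
   beta <= 0 into an inequality at lambda = 0. *)
Lemma wsum_ratio_le b : b <= 0 ->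
  wsum (2 * t) b * wsum t 0 <= wsum t b * wsum (2 * t) 0.
Proof.
move=> b0; pose w j := expR (- b / sigma j ^+ 2).
have e0 p : wsum p 0 = \sum_j sigma j `^ p.
  by apply: eq_bigr => j _; rewrite oppr0 mul0r expR0 mulr1.
rewrite !e0 -subr_ge0.
pose x j := sigma j `^ t.
have x2 j : sigma j `^ (2 * t) = x j ^+ 2 by rewrite powR_sqr.
have -> : wsum t b * (\sum_j sigma j `^ (2 * t)) -
    wsum (2 * t) b * (\sum_j sigma j `^ t) =
    \sum_i \sum_j x i * x j * (x j - x i) * w i.
  rewrite !mulr_suml -sumrB; apply: eq_bigr => i _; rewrite !mulr_sumr -sumrB.
  by apply: eq_bigr => j _; rewrite !x2 /w /x; ring.
(* Symmetrisation: exchanging i and j shows that this sum is twice the one to be bounded, and each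
   of its terms is nonnegative. *)
have : 0 <= \sum_i \sum_j (x i * x j * (x j - x i) * (w i - w j)).
  apply: sumr_ge0 => i _; apply: sumr_ge0 => j _; rewrite -mulrA mulr_ge0//.
    by rewrite mulr_ge0// powR_ge0.
  have mono i' j' : sigma i' <= sigma j' -> 0 <= (x j' - x i') * (w i' - w j').
    move=> ij; rewrite mulr_ge0// subr_ge0.
      by apply: ler_powR2r => //; exact: ltW.
    rewrite ler_expR ler_wpM2l ?oppr_ge0// lef_pV2 ?posrE ?exprn_gt0//.
    by rewrite ler_pXn2r ?nnegrE// ltW.
  have [/mono//|/ltW/mono] := leP (sigma i) (sigma j).
  by rewrite -mulrNN !opprB.
under eq_bigr do under eq_bigr do rewrite mulrBr.
under eq_bigr do rewrite sumrB.
rewrite sumrB.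
rewrite [X in _ <= _ - X](_ : _ = - \sum_i \sum_j x i * x j * (x j - x i) * w i).
  by rewrite opprK; lra.
rewrite exchange_big/= -sumrN; apply: eq_bigr => i _; rewrite -sumrN.
by apply: eq_bigr => j _; ring.
Qed.

Let lam := lambda s t sigma.
Let nu := nu_t s t sigma.

Let nuE : nu = Num.sqrt (wsum (2 * t) (lam ^+ 2)).
Proof. by []. Qed.

Lemma nu_t_gt0 : 0 < nu_t s t sigma.
Proof. by rewrite -/nu nuE sqrtr_gt0 wsum_gt0. Qed.

Lemma lambda_wsum : wsum t (lam ^+ 2) <= s%:R / 2 * nu /\
  (0 < lam -> wsum t (lam ^+ 2) = s%:R / 2 * nu).
Proof.
have := xgetPex 0 beta_equation_solvable; rewrite -/(beta s t sigma).
set b := beta s t sigma => hb.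
have sqb := sqrtr_gt0 (wsum (2 * t) b); rewrite wsum_gt0 in sqb.
have hb' : wsum t b = s%:R / 2 * Num.sqrt (wsum (2 * t) b).
  by rewrite -[s%:R / 2]hb -/(wsum t b) -/(wsum (2 * t) b) divfK// gt_eqF.
have lamE : lam ^+ 2 = Num.max b 0 by rewrite sqr_sqrtr// le_max lexx orbT.
rewrite nuE lamE; have [b0|b0] := leP b 0; last by rewrite hb'; split.
split; last first.
  by rewrite /lam /lambda -/b (max_idPr b0) sqrtr0 ltxx.
have h := wsum_ratio_le b0.
have mono : wsum t 0 <= wsum t b.
  apply: ler_sum => j _; rewrite ler_wpM2l ?powR_ge0// ler_expR.
  by rewrite ler_wpM2r ?invr_ge0 ?sqr_ge0// lerN2.
have w00 := wsum_gt0 t 0; have w20 := wsum_gt0 (2 * t) 0.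
have wb2 := wsum_gt0 (2 * t) b.
have s20 : 0 <= s%:R / 2 :> R by rewrite divr_ge0.
rewrite -(ger0_norm s20) -sqrtr_sqr -sqrtrM ?sqr_ge0//.
rewrite -(ger0_norm (ltW w00)) -sqrtr_sqr; apply: ler_wsqrtr.
rewrite -(ler_pM2r wb2).
have E : wsum t b ^+ 2 = (s%:R / 2) ^+ 2 * wsum (2 * t) b.
  by rewrite hb' exprMn sqr_sqrtr// ltW.
(* In the squared claim one factor [wsum t 0] grows to [wsum t b], and the other is handled by
   [wsum_ratio_le]. *)
apply: (@le_trans _ _ (wsum t b * (wsum t b * wsum (2 * t) 0))).
  rewrite expr2 -mulrA [wsum t 0 * wsum (2 * t) b]mulrC.
  by apply: ler_pM; rewrite ?mulr_ge0// ltW.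
by rewrite mulrA -expr2 E mulrAC.
Qed.

End beta_equation_solution.

(** * Lower bound on the separation radius *)

Section minimax_lower.
Context (R : realType) (t delta : R).
Hypotheses (t0 : 0 < t) (hdelta : 0 < delta < 1).

Let delta0 : 0 < delta. Proof. by case/andP: hdelta. Qed.
Let delta1 : delta < 1. Proof. by case/andP: hdelta. Qed.

Let e : R := expR 1.
Let e1 : 1 <= e. Proof. by have := expR_ge1Dx (1 : R); rewrite /e; lra. Qed.
Let e0 : 0 < e. Proof. exact: expR_gt0. Qed.

(* Chosen so that exp(amplitude_sqr) - 1, 4 * amplitude_sqr and
   amplitude_sqr * e are all at most delta^2. *)
Definition amplitude_sqr : R := delta ^+ 2 / (4 * e).
Definition amplitude : R := Num.sqrt amplitude_sqr.

Let delta20 : 0 < delta ^+ 2. Proof. by rewrite exprn_gt0. Qed.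

Let kappa0 : 0 < amplitude_sqr.
Proof. by rewrite divr_gt0// mulr_gt0. Qed.

Let kappa_e : amplitude_sqr * e = delta ^+ 2 / 4.
Proof. by rewrite /amplitude_sqr; field; rewrite gt_eqF. Qed.

Let delta21 : delta ^+ 2 <= 1.
Proof. by rewrite expr_le1// ltW. Qed.

Let kappa_le : amplitude_sqr <= delta ^+ 2 / 4.
Proof. by rewrite -kappa_e ler_peMr// ltW. Qed.

Let kappa01 : 0 <= amplitude_sqr <= 1.
Proof. by rewrite ltW//=; have := kappa_le; have := delta21; lra. Qed.

Let expR_kappa : expR amplitude_sqr <= 1 + delta ^+ 2.
Proof.
have k2 : 2 * amplitude_sqr <= delta ^+ 2 by have := kappa_le; have := delta20; lra.
have kh : amplitude_sqr <= 2^-1 by have := kappa_le; have := delta21; lra.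
have h : expR amplitude_sqr * (1 - amplitude_sqr) <= 1.
  rewrite -[leRHS](expRxMexpNx_1 amplitude_sqr) ler_pM2l ?expR_gt0//.
  exact: expR_ge1Dx.
have h2 : 0 <= (expR amplitude_sqr) * (2^-1 - amplitude_sqr).
  by rewrite mulr_ge0 ?expR_ge0// subr_ge0.
have h3 : expR amplitude_sqr <= 2 by move: h h2; set x := expR _; nra.
have : expR amplitude_sqr * amplitude_sqr <= 2 * amplitude_sqr by rewrite ler_wpM2r// ltW.
by move: h; lra.
Qed.

Let amp0 : 0 < amplitude. Proof. by rewrite sqrtr_gt0. Qed.
Let amp2 : amplitude ^+ 2 = amplitude_sqr. Proof. by rewrite sqr_sqrtr// ltW. Qed.

Let coshm1_kappa : coshm1 amplitude_sqr <= amplitude_sqr * e.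
Proof. by rewrite -{1}[amplitude_sqr]mulr1; exact: coshm1_mul_le. Qed.

Section lower_fixed_problem.
Context (d : nat) (sigma : 'I_d -> R) (s : nat) (lam nu : R).
Hypotheses (sigma0 : forall j, 0 < sigma j) (s0 : (0 < s)%N).
Hypotheses (lam0 : 0 <= lam) (nu0 : 0 < nu).
Hypothesis nuE : nu ^+ 2 = wsum sigma (2 * t) (lam ^+ 2).
Hypothesis wsum_le : wsum sigma t (lam ^+ 2) <= s%:R / 2 * nu.
Hypothesis wsum_eq : 0 < lam -> wsum sigma t (lam ^+ 2) = s%:R / 2 * nu.

Let sR : 1 <= s%:R :> R. Proof. by rewrite ler1n. Qed.

Lemma lower_one_coordinate (j0 : 'I_d) (eps : R) :
  0 <= eps -> eps `^ t <= (amplitude * sigma j0) `^ t ->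
  ((1 - 2 * delta)%:E <= minimax_risk eps s t sigma)%E.
Proof.
move=> eps0 heps.
apply: (single_index_prior_lower sigma0 t0 (p := fun j => (j == j0)%:R)
  hdelta s0 _ _ _ _ eps0 heps).
- by move=> j; exact: ler0n.
- by rewrite (bigD1 j0)//= eqxx big1 ?addr0// => j /negbTE ->.
- by rewrite mulr_ge0 ?ltW.
- rewrite (bigD1 j0)//= eqxx big1 ?addr0; last first.
    by move=> j /negbTE ->; rewrite expr0n mul0r.
  rewrite expr1n mul1r exprMn mulfK ?expf_neq0 ?gt_eqF// amp2.
  by apply: (le_trans coshm1_kappa); rewrite kappa_e; have := delta20; lra.
Qed.

Let pr j := sigma j `^ t * expR (- lam ^+ 2 / sigma j ^+ 2) / nu.

Let pr0 j : 0 <= pr j.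
Proof. by rewrite divr_ge0 ?(ltW nu0)// mulr_ge0 ?powR_ge0 ?expR_ge0. Qed.

Let pr_sum : \sum_j pr j = wsum sigma t (lam ^+ 2) / nu.
Proof. by rewrite mulr_suml. Qed.

Let pr1 j : pr j <= 1.
Proof.
have x0 : 0 <= sigma j `^ t * expR (- lam ^+ 2 / sigma j ^+ 2).
  by rewrite mulr_ge0 ?powR_ge0 ?expR_ge0.
rewrite ler_pdivrMr// mul1r -ler_sqr ?nnegrE ?(ltW nu0)// nuE.
rewrite /wsum (bigD1 j)//= exprMn powR_sqr -[leLHS]addr0; apply: lerD.
  rewrite ler_wpM2l ?powR_ge0// expr2 ler_piMr ?expR_ge0// expR_le1.
  by rewrite mulNr oppr_le0 divr_ge0// sqr_ge0.
by apply: sumr_ge0 => i _; rewrite mulr_ge0 ?powR_ge0 ?expR_ge0.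
Qed.

Let pr_sqr : \sum_j pr j ^+ 2 * expR (lam ^+ 2 / sigma j ^+ 2) = 1.
Proof.
rewrite -[RHS](divff (x := nu ^+ 2)) ?expf_neq0 ?gt_eqF// {1}nuE mulr_suml.
apply: eq_bigr => j _; rewrite /pr expr_div_n exprMn powR_sqr mulrAC.
congr (_ / _); rewrite -mulrA; congr (_ * _).
by rewrite -expRM_natl -expRD; congr expR; rewrite mulNr; ring.
Qed.

Let coshm1_lam j :
  coshm1 ((amplitude * lam) ^+ 2 / sigma j ^+ 2) <=
  amplitude_sqr * expR (lam ^+ 2 / sigma j ^+ 2).
Proof.
rewrite exprMn amp2 -mulrA; apply: coshm1_mul_le => //.
by rewrite divr_ge0// sqr_ge0.
Qed.

(** [pr] has total mass s / 2, so 2 pr / s is a distribution of one index. The resulting lam^t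
    matches lam^t s up to a constant while s stays bounded. *)
Lemma lower_lambda (eps : R) : 0 < lam ->
  0 <= eps -> eps `^ t <= (amplitude * lam) `^ t ->
  ((1 - 2 * delta)%:E <= minimax_risk eps s t sigma)%E.
Proof.
move=> lamp eps0 heps; have sR0 : 0 < s%:R :> R by rewrite ltr0n.
apply: (single_index_prior_lower sigma0 t0 (p := fun j => 2 / s%:R * pr j)
  hdelta s0 _ _ _ _ eps0 heps).
- by move=> j; rewrite mulr_ge0// divr_ge0.
- rewrite -mulr_sumr pr_sum wsum_eq//; field.
  by rewrite !gt_eqF.
- by rewrite mulr_ge0 ?ltW.
- apply: (@le_trans _ _ (\sum_j (4 * amplitude_sqr) *
      (pr j ^+ 2 * expR (lam ^+ 2 / sigma j ^+ 2)))).
    apply: ler_sum => j _.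
    rewrite (_ : 4 * amplitude_sqr * _ = (2 * pr j) ^+ 2 *
      (amplitude_sqr * expR (lam ^+ 2 / sigma j ^+ 2))); last by ring.
    apply: ler_pM; rewrite ?sqr_ge0 ?coshm1_ge0//.
      have h1 : 0 <= 2 / s%:R * pr j.
        by apply: mulr_ge0 (pr0 j); rewrite divr_ge0.
      have h2 : 0 <= 2 * pr j by apply: mulr_ge0 (pr0 j).
      rewrite ler_pXn2r ?nnegrE//.
      by rewrite ler_wpM2r// ler_pdivrMr// ler_peMr.
  by rewrite -mulr_sumr pr_sqr mulr1; have := kappa_le; lra.
Qed.

(** All amplitudes are equal, so the norm condition of the product prior reads 8 (s / 2) <= delta (s
    / 2)^2, which is 16 <= delta s. *)
Lemma lower_lambda_sparsity (eps : R) : 0 < lam -> 16 <= delta * s%:R ->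
  0 <= eps -> eps `^ t <= (amplitude * lam) `^ t * s%:R / 4 ->
  ((1 - 2 * delta)%:E <= minimax_risk eps s t sigma)%E.
Proof.
move=> lamp hs eps0 heps.
set X := (amplitude * lam) `^ t.
have X0 : 0 < X by rewrite powR_gt0// mulr_gt0.
have sumpr : \sum_j pr j = s%:R / 2.
  by rewrite pr_sum wsum_eq// mulfK// gt_eqF.
have sumprM c : \sum_j pr j * c = s%:R / 2 * c by rewrite -mulr_suml sumpr.
apply: (product_prior_lower sigma0 t0 (pr := pr) (a := fun=> amplitude * lam)
  (kappa := amplitude_sqr) hdelta _ _ _ expR_kappa _ _ _ _ eps0).
- by move=> j; rewrite pr0 pr1.
- by move=> j; rewrite mulr_ge0 ?ltW.
- rewrite -[leRHS]mulr1 -pr_sqr mulr_sumr; apply: ler_sum => j _.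
  by rewrite mulrCA ler_wpM2l ?sqr_ge0// coshm1_lam.
- by rewrite sumpr.
- by lra.
- rewrite /= sumprM -/X.
  by rewrite mulr_gt0// divr_gt0// (lt_le_trans ltr01).
- rewrite /= !sumprM -powR_sqr -/X.
  have := mulr_ge0 (sqr_ge0 X) (le_trans ler01 sR).
  have : X ^+ 2 * s%:R * 16 <= X ^+ 2 * s%:R * (delta * s%:R).
    by rewrite ler_wpM2l// mulr_ge0 ?sqr_ge0.
  by lra.
- by rewrite /= sumprM -/X; move: heps; rewrite -/X; lra.
Qed.

Let A2 := \sum_(j < d | lam <= sigma j) sigma j `^ (2 * t).
Let A := Num.sqrt A2.
(** Makes the mean support size in [lower_dense] at most (k1 / A) (e s A) = s / 4. *)
Let k1 := (4 * e)^-1.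

Let k10 : 0 < k1. Proof. by rewrite invr_gt0 mulr_gt0. Qed.
Let k11 : k1 <= 1.
Proof. by rewrite invf_le1 ?mulr_gt0//; have := e1; lra. Qed.

Let A20 : 0 <= A2. Proof. by apply: sumr_ge0 => j _; exact: powR_ge0. Qed.
Let A_sqr : A ^+ 2 = A2. Proof. by rewrite sqr_sqrtr. Qed.

Let expR_above j : lam <= sigma j -> e^-1 <= expR (- lam ^+ 2 / sigma j ^+ 2).
Proof.
move=> hj; rewrite -expRN ler_expR mulNr lerN2 ler_pdivrMr ?exprn_gt0//.
by rewrite mul1r ler_pXn2r ?nnegrE// ltW.
Qed.

Lemma above_threshold_le_nu : A <= e * nu.
Proof.
have H : A2 <= e * nu ^+ 2.
  rewrite nuE /wsum mulr_sumr [leRHS](bigID (fun j => lam <= sigma j))/=.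
  rewrite -[leLHS]addr0; apply: lerD; last first.
    by apply: sumr_ge0 => j _; rewrite !mulr_ge0 ?expR_ge0 ?powR_ge0// ltW.
  apply: ler_sum => j hj; rewrite mulrCA -[leLHS]mulr1 ler_wpM2l ?powR_ge0//.
  by rewrite -ler_pdivrMl// mulr1 expR_above.
rewrite -ler_sqr ?nnegrE ?sqrtr_ge0 ?mulr_ge0 ?(ltW nu0) ?(ltW e0)//.
rewrite A_sqr exprMn; apply: (le_trans H); rewrite ler_wpM2r ?sqr_ge0//.
by rewrite expr2 ler_peMr// ltW.
Qed.

(** Below the threshold sigma_j^(2t) <= lam^t sigma_j^t, so [wsum_le] bounds that part of nu^2 by P
    nu. Then nu^2 <= A^2 + P nu forces nu <= A + P. *)
Lemma nu_le_above_threshold : nu <= A + lam `^ t * s%:R / 2.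
Proof.
set P := lam `^ t * s%:R / 2.
have P0 : 0 <= P by rewrite divr_ge0// mulr_ge0 ?powR_ge0.
have H : nu ^+ 2 <= A ^+ 2 + P * nu.
  rewrite A_sqr nuE /wsum (bigID (fun j => lam <= sigma j))/=; apply: lerD.
    apply: ler_sum => j _; rewrite ler_piMr ?powR_ge0// expR_le1.
    by rewrite mulNr oppr_le0 divr_ge0// sqr_ge0.
  apply: (@le_trans _ _ (lam `^ t * wsum sigma t (lam ^+ 2))).
    rewrite /wsum mulr_sumr [leRHS](bigID (fun j => lam <= sigma j))/=.
    rewrite -[leLHS]add0r; apply: lerD.
      by apply: sumr_ge0 => j _; rewrite !mulr_ge0 ?expR_ge0 ?powR_ge0.
    apply: ler_sum => j; rewrite -ltNge => hj.
    rewrite mulrA ler_wpM2r ?expR_ge0// -powR_sqr expr2 ler_wpM2r ?powR_ge0//.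
    by apply: ler_powR2r; exact: ltW.
  rewrite /P -!mulrA ler_wpM2l ?powR_ge0// mulrA.
  exact: wsum_le.
have A0 : 0 <= A by exact: sqrtr_ge0.
rewrite leNgt; apply/negP => h.
by move: H; nra.
Qed.

(** Amplitudes proportional to sigma_j make the signal-to-noise ratio constant. The bound on lam^t s
    gives nu <= 2 A, hence a small mean support; the bound on smax^t keeps any coordinate from
    dominating the variance of the norm, where sigma_j^(3t) <= smax^t sigma_j^(2t). *)
Lemma lower_dense (smax eps : R) : 16 <= delta * s%:R ->
  (forall j, sigma j <= smax) -> 0 < A -> lam `^ t * s%:R <= 2 * A ->
  8 * smax `^ t <= delta * k1 * A ->
  0 <= eps -> eps `^ t <= amplitude `^ t * k1 * A / 2 ->
  ((1 - 2 * delta)%:E <= minimax_risk eps s t sigma)%E.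
Proof.
move=> hs hmax A0 hlam hA eps0 heps.
have S0 : \sum_(j < d | lam <= sigma j) sigma j `^ t <= e * s%:R * A.
  apply: (@le_trans _ _ (e * wsum sigma t (lam ^+ 2))).
    rewrite /wsum mulr_sumr [leRHS](bigID (fun j => lam <= sigma j))/=.
    rewrite -[leLHS]addr0; apply: lerD; last first.
      by apply: sumr_ge0 => j _; rewrite !mulr_ge0 ?expR_ge0 ?powR_ge0// ltW.
    apply: ler_sum => j hj; rewrite mulrCA -[leLHS]mulr1 ler_wpM2l ?powR_ge0//.
    by rewrite -ler_pdivrMl// mulr1 expR_above.
  rewrite -mulrA ler_wpM2l ?(ltW e0)//; apply: (le_trans wsum_le).
  have nu2A : nu <= 2 * A by have := nu_le_above_threshold; lra.
  by have := ler_wpM2l (le_trans ler01 sR) nu2A; lra.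
pose q j := if lam <= sigma j then k1 * sigma j `^ t / A else 0.
have q0 j : 0 <= q j.
  rewrite /q; case: ifP => // _.
  by rewrite divr_ge0 ?(ltW A0)// mulr_ge0 ?powR_ge0// ltW.
have qsum (g : 'I_d -> R) : \sum_j q j * g j =
    k1 / A * \sum_(j < d | lam <= sigma j) sigma j `^ t * g j.
  rewrite mulr_sumr [RHS]big_mkcond/=; apply: eq_bigr => j _.
  by rewrite /q; case: ifP => _; [field; rewrite gt_eqF|rewrite mul0r].
have muE : \sum_j q j * (amplitude * sigma j) `^ t = k1 * amplitude `^ t * A.
  rewrite qsum (_ : \sum_(j < d | _) _ = amplitude `^ t * A ^+ 2); last first.
    rewrite A_sqr mulr_sumr; apply: eq_bigr => j _.
    by rewrite powRM ?(ltW amp0) ?(ltW (sigma0 j))// -powR_sqr; ring.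
  by field; rewrite gt_eqF.
have ampt0 : 0 < amplitude `^ t by rewrite powR_gt0.
apply: (product_prior_lower sigma0 t0 (pr := q) (a := fun j => amplitude * sigma j)
  (kappa := amplitude_sqr) hdelta _ _ _ expR_kappa _ _ _ _ eps0).
- move=> j; rewrite q0/= /q; case: ifP => // hj.
  rewrite ler_pdivrMr// mul1r; apply: (@le_trans _ _ (sigma j `^ t)).
    by rewrite ler_piMl ?powR_ge0.
  rewrite -ler_sqr ?nnegrE ?powR_ge0 ?(ltW A0)// A_sqr powR_sqr /A2 (bigD1 j)//=.
  by rewrite lerDl; apply: sumr_ge0 => i _; exact: powR_ge0.
- by move=> j; rewrite mulr_ge0 ?ltW.
- apply: (@le_trans _ _ (\sum_(j < d | lam <= sigma j)
      (k1 ^+ 2 / A ^+ 2) * (sigma j `^ (2 * t)) * (amplitude_sqr * e))).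
    rewrite [leRHS]big_mkcond/=; apply: ler_sum => j _.
    rewrite /q; case: ifP => hj; last by rewrite expr0n mul0r.
    rewrite [(amplitude * sigma j) ^+ 2]exprMn mulfK ?expf_neq0 ?gt_eqF// amp2.
    rewrite expr_div_n exprMn powR_sqr [X in X * _]mulrAC.
    apply: ler_wpM2l; last exact: coshm1_kappa.
    by rewrite mulr_ge0 ?powR_ge0// divr_ge0 ?sqr_ge0.
  rewrite -mulr_suml -mulr_sumr -/A2 A_sqr divfK ?gt_eqF -?A_sqr ?exprn_gt0//.
  rewrite mulrCA ler_piMr ?(ltW kappa0)//.
  rewrite expr2 -mulrA (_ : k1 * e = 4^-1); last first.
    by rewrite /k1; field; rewrite gt_eqF.
  by have := k11; lra.
- rewrite (eq_bigr (fun j => q j * 1)) ?qsum; last by move=> j _; rewrite mulr1.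
  under eq_bigr do rewrite mulr1.
  have H : k1 / A * (e * s%:R * A) = s%:R / 4.
    by rewrite /k1; field; rewrite !gt_eqF.
  have := ler_wpM2l (_ : 0 <= k1 / A) S0; rewrite H.
  have : 0 <= k1 / A by rewrite divr_ge0 ?ltW.
  by have := sR; move=> ? h1 h2; have := h2 h1; lra.
- by lra.
- by rewrite muE !mulr_gt0.
- rewrite muE qsum.
  have H : \sum_(j < d | lam <= sigma j) sigma j `^ t * (amplitude * sigma j) `^ (2 * t)
     <= smax `^ t * ((amplitude `^ t) ^+ 2 * A ^+ 2).
    rewrite A_sqr !mulr_sumr; apply: ler_sum => j _.
    rewrite powRM ?(ltW amp0) ?(ltW (sigma0 j))// -powR_sqr.
    apply: ler_pM; rewrite ?mulr_ge0 ?sqr_ge0 ?powR_ge0//.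
    by apply: ler_powR2r; [exact: ltW|exact: ltW|exact: hmax].
  have k1A : 0 <= k1 / A by rewrite divr_ge0 ?ltW.
  have := ler_wpM2l k1A H.
  rewrite (_ : k1 / A * (smax `^ t * _) = k1 * (amplitude `^ t) ^+ 2 * A * smax `^ t); last first.
    by field; rewrite gt_eqF.
  have Z0 : 0 <= k1 * (amplitude `^ t) ^+ 2 * A.
    by rewrite !mulr_ge0 ?sqr_ge0// ltW.
  have := ler_wpM2l Z0 hA.
  by lra.
- by rewrite muE; move: heps; lra.
Qed.

End lower_fixed_problem.
End minimax_lower.

(** * Assembling the rates and the separation radius *)

Section minimax_rates.
Context (R : realType).
Implicit Types (eta t eps lam nu : R).

(** Each prior is used in contrapositive form: a radius with risk at most eta must exceed the radius
    of that prior. *)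
Theorem minimax_risk_lower eta t : 0 < eta < 1 -> 0 < t ->
  exists2 K : R, 0 < K & forall d (sigma : 'I_d -> R) (s : nat) (j0 : 'I_d) lam nu eps,
    (forall j, 0 < sigma j) -> (forall j, sigma j <= sigma j0) -> (0 < s)%N ->
    0 <= lam -> 0 < nu -> nu ^+ 2 = wsum sigma (2 * t) (lam ^+ 2) ->
    wsum sigma t (lam ^+ 2) <= s%:R / 2 * nu ->
    (0 < lam -> wsum sigma t (lam ^+ 2) = s%:R / 2 * nu) ->
    0 < eps -> (minimax_risk eps s t sigma <= eta%:E)%E ->
    lam `^ t * s%:R + nu <= K * eps `^ t.
Proof.
move=> /andP[eta0 eta1] t0.
have [delta hdelta eta_delta] : exists2 delta, 0 < delta < 1 & eta < 1 - 2 * delta.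
  by exists ((1 - eta) / 4); [apply/andP; split; lra|lra].
have /andP[delta0 delta1] := hdelta.
have amp0 : 0 < amplitude delta.
  by rewrite sqrtr_gt0 divr_gt0 ?exprn_gt0// mulr_gt0// expR_gt0.
set ct := amplitude delta `^ t; have ct0 : 0 < ct by rewrite powR_gt0.
set k1 := (4 * expR 1)^-1 : R.
have k10 : 0 < k1 by rewrite invr_gt0 mulr_gt0// expR_gt0.
have k11 : k1 <= 1.
  rewrite invf_le1 ?mulr_gt0 ?expR_gt0//.
  by have := expR_ge1Dx (1 : R); lra.
(* One constant for all cases: each bounds delta k1 ct times its term by at most 16 X, and [step]
   concludes. *)
set K := 16 / (delta * k1 * ct).
have K0 : 0 < K by rewrite divr_gt0// !mulr_gt0.
exists (2 * K); first by rewrite mulr_gt0.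
move=> d sigma s j0 lam nu eps sigma0 top s0 lam0 nu0 nuE wle weq eps0 hrisk.
have no : ~~ ((1 - 2 * delta)%:E <= minimax_risk eps s t sigma)%E.
  by rewrite -ltNge (le_lt_trans hrisk)// lte_fin.
have sR : 1 <= s%:R :> R by rewrite ler1n.
set X := eps `^ t; have X0 : 0 < X by rewrite powR_gt0.
have powRct x : 0 <= x -> (amplitude delta * x) `^ t = ct * x `^ t.
  by move=> x0; rewrite powRM// ltW.
have KE : delta * k1 * ct * K = 16 by rewrite /K; field; rewrite !gt_eqF.
have step (x : R) (b : nat) : (b <= 16)%N -> delta * k1 * ct * x <= b%:R * X ->
    x <= K * X.
  move=> b16 h; have D0 : 0 < delta * k1 * ct by rewrite !mulr_gt0.
  rewrite -(ler_pM2l D0) mulrA KE; apply: (le_trans h).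
  by rewrite ler_wpM2r ?(ltW X0)// ler_nat.
have dk : delta * k1 <= 1 by rewrite mulr_ile1 ?(ltW delta0) ?(ltW k10) ?(ltW delta1).
have h1 : ct * sigma j0 `^ t <= X.
  rewrite leNgt; apply: (contra _ no) => h.
  apply: (lower_one_coordinate t0 hdelta sigma0 s0 (j0 := j0) (ltW eps0)).
  by rewrite powRct ?ltW.
have smax0 : 0 <= sigma j0 `^ t by exact: powR_ge0.
have L0 : 0 <= lam `^ t by exact: powR_ge0.
have h2 : lam `^ t * s%:R <= K * X.
  have [lamle|lamp] := leP lam 0.
    have -> : lam = 0 by apply/eqP; rewrite eq_le lamle.
    by rewrite powR0 ?gt_eqF// mul0r mulr_ge0// ltW.
  (* If delta s < 16, the factor s is a constant and a single random coordinate suffices. *)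
  have [hs|hs] := leP 16 (delta * s%:R).
    have h : ct * lam `^ t * s%:R <= 4 * X.
      rewrite leNgt; apply: (contra _ no) => h.
      apply: (lower_lambda_sparsity t0 hdelta sigma0 s0 nu0 nuE weq lamp hs (ltW eps0)).
      by rewrite powRct// -/X; move: h; clear; lra.
    apply: (@step _ 4%N) => //; apply: le_trans h.
    have := ler_wpM2r (mulr_ge0 (mulr_ge0 (ltW ct0) L0) (le_trans ler01 sR)) dk.
    by clear; lra.
  have h : ct * lam `^ t <= X.
    rewrite leNgt; apply: (contra _ no) => h.
    apply: (lower_lambda t0 hdelta sigma0 s0 nu0 nuE weq lamp (ltW eps0)).
    by rewrite powRct// ltW.
  apply: (@step _ 16%N) => //.
  have P0 : 0 <= ct * lam `^ t by apply: mulr_ge0 => //; exact: ltW.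
  apply: (@le_trans _ _ (delta * s%:R * (ct * lam `^ t))).
    have dP0 : 0 <= delta * s%:R * (ct * lam `^ t).
      by do 2![apply: mulr_ge0 => //]; exact: ltW.
    by have := ler_wpM2r dP0 k11; clear; lra.
  by apply: ler_pM; rewrite ?mulr_ge0// ltW.
set A := Num.sqrt (\sum_(j < d | lam <= sigma j) sigma j `^ (2 * t)).
have nuA : nu <= A + lam `^ t * s%:R / 2.
  exact: (nu_le_above_threshold t0 sigma0 nuE wle).
have A0 : 0 <= A by exact: sqrtr_ge0.
suff h3 : nu <= K * X by move: h2 h3; clear; lra.
(* For bounded s, nu^2 <= sigma_1^t [wsum t] gives nu <= sigma_1^t s / 2, and the first coordinate
   alone is hard enough. *)
have [hs|hs] := ltP (delta * s%:R) 16.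
  have nus : nu <= sigma j0 `^ t * s%:R / 2.
    rewrite -(ler_pM2r nu0) -expr2 nuE.
    apply: (@le_trans _ _ (sigma j0 `^ t * wsum sigma t (lam ^+ 2))).
      rewrite /wsum mulr_sumr; apply: ler_sum => j _.
      rewrite mulrA ler_wpM2r ?expR_ge0// -powR_sqr expr2 ler_wpM2r ?powR_ge0//.
      by apply: ler_powR2r; [exact: ltW|exact: ltW|exact: top].
    by have := ler_wpM2l smax0 wle; clear; lra.
  apply: (@step _ 8%N) => //.
  have P0 : 0 <= delta * k1 * ct by apply/ltW; rewrite !mulr_gt0.
  apply: (le_trans (ler_wpM2l P0 nus)).
  have Q0 : 0 <= ct * sigma j0 `^ t by apply: mulr_ge0 => //; exact: ltW.
  have : delta * s%:R * (ct * sigma j0 `^ t) <= 16 * X.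
    by apply: ler_pM; rewrite ?mulr_ge0// ltW.
  have W0 : 0 <= delta * s%:R * (ct * sigma j0 `^ t).
    by do 2![apply: mulr_ge0 => //]; exact: ltW.
  by have := ler_wpM2r W0 k11; move: X0; clear; lra.
(* For large s, either lam^t s dominates A and [h2] concludes, or nu <= 2 A. Then A is bounded by a
   multiple of sigma_1^t, or [lower_dense] applies. *)
have [hlam|hlam] := ltP (2 * A) (lam `^ t * s%:R).
  by move: nuA h2 hlam; clear; lra.
have Ap : 0 < A.
  rewrite lt_neqAle A0 andbT eq_sym; apply/eqP => Az.
  by move: nuA hlam nu0; rewrite Az; clear; lra.
have [hA|hA] := ltP (delta * k1 * A) (8 * sigma j0 `^ t).
  apply: (@step _ 16%N) => //.
  have nu2 : nu <= 2 * A by move: nuA hlam; clear; lra.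
  have P0 : 0 <= delta * k1 * ct by apply/ltW; rewrite !mulr_gt0.
  have := ler_wpM2l P0 nu2; have := ler_wpM2l (ltW ct0) (ltW hA).
  by move: h1; clear; lra.
have h : ct * k1 * A <= 2 * X.
  rewrite leNgt; apply: (contra _ no) => h.
  apply: (lower_dense t0 hdelta sigma0 s0 lam0 nuE wle hs top Ap hlam hA (ltW eps0)).
  by rewrite -/X -/ct -/k1 -/A; move: h; clear; lra.
apply: (@step _ 4%N) => //.
have nu2 : nu <= 2 * A by move: nuA hlam; clear; lra.
have P0 : 0 <= delta * k1 * ct by apply/ltW; rewrite !mulr_gt0.
have := ler_wpM2l P0 nu2.
have Q0 : 0 <= ct * k1 * A by do 2![apply: mulr_ge0 => //]; exact: ltW.
by have := ler_wpM2r Q0 (ltW delta1); move: h; clear; lra.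
Qed.

(** As sigma is nonincreasing, the indices above the threshold form an initial segment, of length
    [j_star]. Counting from 1 leaves the value 0 for the empty segment. *)
Lemma j_starP d (sigma : 'I_d -> R) s t (j : 'I_d) :
  (forall i j : 'I_d, (i <= j)%N -> sigma j <= sigma i) ->
  (j.+1 <= j_star s t sigma)%N = (lambda s t sigma <= sigma j).
Proof.
move=> noninc; apply/idP/idP => [|h]; last first.
  by rewrite /j_star; apply: (leq_bigmax_cond (F := fun i : 'I_d => i.+1)).
rewrite leNgt; apply: contraL => h; rewrite -leqNgt.
apply/bigmax_leqP => i hi; rewrite ltnNge; apply/negP => /noninc ij.
by have := lt_le_trans h hi; rewrite ltNge ij.
Qed.

End minimax_rates.

Theorem corollary1 (R : realType) (eta t : R) (heta0 : 0 < eta)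
    (heta1 : eta < 1) (ht : 2 <= t) :
  exists c C : R, 0 < c /\ 0 < C /\
    forall (d : nat) (sigma : 'I_d -> R) (s : nat),
      (1 <= d)%N ->
      (forall j, 0 < sigma j) ->
      (forall i j : 'I_d, (i <= j)%N -> sigma j <= sigma i) ->
      (1 <= s <= d)%N ->
      let eps_t := poweR (eps_star eta s t sigma) t in
      let rate1 := lambda s t sigma `^ t * s%:R + nu_t s t sigma in
      let rate2 := lambda s t sigma `^ t * s%:R +
        Num.sqrt (\sum_(j < d | (j.+1 <= j_star s t sigma)%N)
                     sigma j `^ (2 * t)) in
      ((c * rate1)%:E <= eps_t)%E /\ (eps_t <= (C * rate1)%:E)%E /\
      c * rate2 <= rate1 /\ rate1 <= C * rate2.
Proof.
have t0 : 0 < t by rewrite (lt_le_trans _ ht).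
have [U U0 upper] := minimax_risk_upper heta0 ht.
have heta : 0 < eta < 1 by rewrite heta0.
have [K K0 lower] := minimax_risk_lower heta t0.
pose e : R := expR 1.
have e1 : 1 <= e by have := expR_ge1Dx (1 : R); rewrite /e; lra.
have e0 : 0 < e by exact: expR_gt0.
(* [K] and [U] bound the separation radius; e and 2 compare the rates, through A <= e nu and nu <= A
   + L / 2. *)
pose c := (K + e)^-1; pose C := U + 2.
have Ke0 : 0 < K + e by rewrite addr_gt0.
exists c, C; split; first by rewrite invr_gt0.
split; first by rewrite addr_gt0.
move=> d sigma s d1 sigma0 noninc sd eps_t.
set lam := lambda s t sigma; set nu := nu_t s t sigma => /=.
have s0 : (0 < s)%N by case/andP: sd.
have lam0 : 0 <= lam by exact: sqrtr_ge0.
have nu0 : 0 < nu by exact: nu_t_gt0.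
have nuE : nu ^+ 2 = wsum sigma (2 * t) (lam ^+ 2).
  by rewrite sqr_sqrtr//; apply/ltW/wsum_gt0.
have [wle weq] := lambda_wsum d1 sigma0 noninc t0 sd.
rewrite -/lam -/nu in wle weq.
rewrite (eq_bigl (fun j => lam <= sigma j)); last by move=> j; exact: j_starP.
set L := lam `^ t * s%:R; set A := Num.sqrt _.
have L0 : 0 <= L by rewrite mulr_ge0 ?powR_ge0.
have A0 : 0 <= A by exact: sqrtr_ge0.
have M0 : 0 < L + nu by rewrite ltr_wpDl.
have star0 : (0 <= eps_star eta s t sigma)%E.
  by apply: le_ereal_inf_tmp => _ [eps [eps0 _] <-]; rewrite lee_fin ltW.
have ti0 : 0 < t^-1 by rewrite invr_gt0.
have rootK x : 0 <= x -> (x `^ t^-1) `^ t = x.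
  by move=> x0; rewrite -powRrM mulVf ?gt_eqF// powRr1.
have poweR_le (x y : \bar R) : (0 <= x -> x <= y -> poweR x t <= poweR y t)%E.
  move=> x0 xy; apply: (gt0_ler_poweR (ltW t0)); rewrite ?in_itv/= ?leey ?andbT//.
  exact: le_trans xy.
split.
  apply: (@le_trans _ _ ((K^-1 * (L + nu))%:E)).
    rewrite lee_fin ler_wpM2r ?(ltW M0)// lef_pV2 ?posrE//.
    by rewrite lerDl ltW.
  have y0 : 0 <= K^-1 * (L + nu) by rewrite mulr_ge0 ?invr_ge0 ?ltW.
  rewrite -(rootK _ y0) -poweR_EFin; apply: poweR_le.
    by rewrite lee_fin powR_ge0.
  apply: le_ereal_inf_tmp => _ [eps [eps0 hrisk] <-]; rewrite lee_fin.
  have [j0 top] : exists j0 : 'I_d, forall j, sigma j <= sigma j0.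
    by exists (Ordinal d1) => j; exact: noninc.
  have := lower _ _ _ _ _ _ _ sigma0 top s0 lam0 nu0 nuE wle weq eps0 hrisk.
  rewrite -/L => H.
  rewrite -[leRHS](powRr1 (ltW eps0)) -(mulfV (lt0r_neq0 t0)) powRrM.
  by apply: ler_powR2r; rewrite ?(ltW ti0)// ler_pdivrMl.
split.
  apply: (@le_trans _ _ ((U * (L + nu))%:E)); last first.
    by rewrite lee_fin ler_wpM2r ?(ltW M0)// lerDl.
  (* The t-th root of this number is an admissible radius, so the infimum defining [eps_star] is
     over a nonempty set and is finite. *)
  have y0 : 0 < U * (L + nu) by rewrite mulr_gt0.
  rewrite -(rootK _ (ltW y0)) -poweR_EFin; apply: poweR_le => //.
  apply: ereal_inf_lbound; exists ((U * (L + nu)) `^ t^-1) => //.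
  split; first by rewrite powR_gt0.
  apply: (upper _ _ _ lam nu) => //; first by rewrite powR_gt0.
  by rewrite rootK// ltW.
have Anu : A <= e * nu := above_threshold_le_nu sigma0 lam0 nu0 nuE.
have nuA : nu <= A + L / 2 := nu_le_above_threshold t0 sigma0 nuE wle.
split.
  rewrite ler_pdivrMl//.
  have : L <= e * L by rewrite ler_peMl.
  have : 0 <= K * (L + nu) by rewrite mulr_ge0 ?ltW.
  by lra.
have : 0 <= U * (L + A) by rewrite mulr_ge0 ?addr_ge0// ltW.
by rewrite /C; lra.
Qed.
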